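(* Let $m=(m_1,\dots,m_t)\in\mathbb{Z}_+^t$ be a vector of positive integers. The following are equivalent: (i) $m$ is the $f$-vector of a simplicial complex; (ii) $m$ is the $h$-vector of a balanced, vertex decomposable simplicial complex; (iii) $m$ is the $h$-vector of a balanced, shellable simplicial complex; (iv) $m$ is the $h$-vector of a balanced, Cohen-Macaulay simplicial complex. Here $h$-vectors are identified up to trailing zeros.
   Context: All simplicial complexes are finite and contain the empty face. A simplicial complex $\Delta$ on a finite vertex set $V$ is a collection of subsets of $V$ closed under taking subsets; its elements are faces and its inclusion-maximal faces are facets. A face $\sigma$ has dimension $|\sigma|-1$; $\dim\Delta$ is the maximum dimension of a facet; $\Delta$ is pure if all facets have the same dimension. A simplex is a complex with exactly one facet (including $\{\emptyset\}$). If $\dim\Delta=d$, the $f$-vector is $f(\Delta)=(f_{-1},f_0,\dots,f_d)$, with $f_i$ the number of faces of dimension $i$. The $h$-vector is $h(\Delta)=(h_0,\dots,h_{d+1})$ with $h_k=\sum_{i=0}^k(-1)^{k-i}\binom{d+1-i}{k-i}f_{i-1}$. Trailing zeros of an $h$-vector are ignored: ''$m$ is the $h$-vector of $\Delta$'' means that $h(\Delta)$ equals $m$ after removing trailing zeros. An $s$-colouring of $\Delta$ is a partition $V=V_1\cup\dots\cup V_s$ into pairwise disjoint, possibly empty sets with $|F\cap V_j|\le1$ for every facet $F$ and every $j$. A complex of dimension $d-1$ is balanced if it has a $d$-colouring. For a vertex $v$ with $\{v\}\in\Delta$: $\Delta\setminus v=\{\tau\in\Delta : v\notin\tau\}$ and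 ${\rm link}_\Delta(v)=\{\tau\in\Delta : v\notin\tau,\ \tau\cup\{v\}\in\Delta\}$. A pure complex is vertex decomposable if it is a simplex, or it has a vertex $v$ such that $\Delta\setminus v$ and ${\rm link}_\Delta(v)$ are both (pure and) vertex decomposable. A pure complex is shellable if its facets can be ordered $F_1,\dots,F_r$ so that for all $1\le i<j\le r$ there exist $v\in F_j\setminus F_i$ and $\ell\in\{1,\dots,j-1\}$ with $F_j\setminus F_\ell=\{v\}$. Fix a field $k$. $\Delta$ is Cohen-Macaulay if its Stanley-Reisner ring $k[V]/I_\Delta$ is Cohen-Macaulay, where $I_\Delta$ is generated by the squarefree monomials $\prod_{x\in\sigma}x$, $\sigma\subseteq V$, $\sigma\notin\Delta$. *)

(* Defs.v *)
From HB Require Import structures.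
From mathcomp Require Import all_boot all_order all_algebra.
From mathcomp Require Import ring_quotient.
From mathcomp Require Import boolp.
From mathcomp Require Import mpoly.

Set Implicit Arguments.
Unset Strict Implicit.
Unset Printing Implicit Defensive.

Import GRing.Theory.
Local Open Scope ring_scope.

(* The vertex set is the whole of V; elements of V need not be faces. *)
Record complex (V : finType) := Complex {
  faces :> {set {set V}};
  complex_set0 : set0 \in faces;
  complex_sub : forall s t : {set V}, s \subset t -> t \in faces -> s \in faces
}.

Section Combinatorics.
Variable V : finType.
Implicit Types (D : {set {set V}}) (v : V) (s : nat).

Definition facets D : {set {set V}} := [set F | maxset (fun G => G \in D) F].

(* A face F has dimension #|F| - 1, so this is dim D + 1, which is 0 for the
   complex whose only face is the empty one. *)
Definition dimS D : nat := \max_(F in facets D) #|F|.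

Definition pure D : Prop := {in facets D &, forall F G : {set V}, #|F| = #|G|}.

Definition simplex D : Prop := #|facets D| = 1%N.

(* f_(i-1), the number of faces with i elements. *)
Definition fnum D (i : nat) : nat := #|[set F in D | #|F| == i]|.

Definition f_vector D : seq nat := mkseq (fnum D) (dimS D).+1.

Definition hnum D (j : nat) : int :=
  \sum_(i < j.+1) (-1) ^+ (j - i) * ('C(dimS D - i, j - i) * fnum D i)%:Z.

Definition h_vector D : seq int := mkseq (hnum D) (dimS D).+1.

(* The colour classes may be empty. *)
Definition colouring s D (C : 'I_s -> {set V}) : Prop :=
  [/\ \bigcup_j C j = [set: V],
      forall i j, i != j -> [disjoint C i & C j]
    & forall F j, F \in facets D -> (#|F :&: C j| <= 1)%N].

Definition balanced D : Prop := exists C, @colouring (dimS D) D C.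

Definition deletion D v : {set {set V}} := [set t in D | v \notin t].

Definition link D v : {set {set V}} :=
  [set t in D | (v \notin t) && (v |: t \in D)].

Inductive vertex_decomposable : {set {set V}} -> Prop :=
| Vd_simplex D : simplex D -> vertex_decomposable D
| Vd_vertex D v : pure D -> [set v] \in D ->
    vertex_decomposable (deletion D v) -> vertex_decomposable (link D v) ->
    vertex_decomposable D.

Definition shelling D (Fs : seq {set V}) : Prop :=
  [/\ uniq Fs, Fs =i facets D
    & forall i j, (i < j < size Fs)%N ->
        exists v l, [/\ v \in nth set0 Fs j :\: nth set0 Fs i, (l < j)%N
                      & nth set0 Fs j :\: nth set0 Fs l = [set v]]].

Definition shellable D : Prop := pure D /\ exists Fs, shelling D Fs.

End Combinatorics.

Definition trim (h : seq int) : seq int :=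
  foldr (fun x t => if (x == 0) && nilp t then [::] else x :: t) [::] h.

Definition is_h_vector (V : finType) (m : seq nat) (D : {set {set V}}) : Prop :=
  trim (h_vector D) = map Posz m.

Section CohenMacaulay.
Variable R : comNzRingType.
Implicit Types (P Q : {pred R}) (a : seq R) (x : R).

Definition in_ideal a x : Prop :=
  exists c : 'I_(size a) -> R, x = \sum_i c i * a`_i.

Definition regular_sequence a : Prop :=
  (forall i x, (i < size a)%N ->
     in_ideal (take i a) (a`_i * x) -> in_ideal (take i a) x)
  /\ ~ in_ideal a 1.

(* idealr_closed includes properness. *)
Definition prime_ideal P : Prop := idealr_closed P /\ prime_idealr_closed P.

Definition maximal_ideal P : Prop :=
  idealr_closed P /\
  forall Q, idealr_closed Q -> {subset P <= Q} -> {subset Q <= P}.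

Definition prime_chain P (n : nat) : Prop :=
  exists Q : nat -> {pred R},
    [/\ forall i, (i <= n)%N -> prime_ideal (Q i),
        forall i, (i < n)%N ->
          {subset Q i <= Q i.+1} /\ ~ {subset Q i.+1 <= Q i}
      & Q n =i P].

Definition regular_length P (n : nat) : Prop :=
  exists a, [/\ size a = n, {subset a <= P} & regular_sequence a].

Definition is_sup (S : nat -> Prop) (n : nat) : Prop :=
  S n /\ forall i, S i -> (i <= n)%N.

Definition has_depth P : nat -> Prop := is_sup (regular_length P).

Definition has_height P : nat -> Prop := is_sup (prime_chain P).

(* For Noetherian R, where depth and height are finite, and the depth and the
   height of a maximal ideal P are those of the local ring R_P. *)
Definition cohen_macaulay : Prop :=
  forall P, maximal_ideal P -> exists n, has_depth P n /\ has_height P n.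

End CohenMacaulay.

Section StanleyReisner.
Variables (k : fieldType) (V : finType).

Definition face_monomial (s : {set V}) : {mpoly k[#|V|]} :=
  \prod_(x in s) 'X_(enum_rank x).

Definition sr_ideal (D : complex V) : {pred {mpoly k[#|V|]}} :=
  [pred p | `[< in_ideal [seq face_monomial s | s in ~: faces D] p >]].

Lemma sr_ideal_closed D : idealr_closed (sr_ideal D).
Proof.
split.
- by apply/asboolP; exists (fun=> 0); rewrite big1 // => i _; rewrite mul0r.
- apply/negP => /asboolP [c /(congr1 (meval (fun=> 0)))].
  rewrite meval1 raddf_sum big1 => [/eqP|i _]; first by rewrite oner_eq0.
  have /mapP [s] := mem_nth 0 (ltn_ord i).
  rewrite mem_enum inE => sD /= ->; rewrite mevalM.
  have [x xs] : exists x, x \in s.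
    by apply/set0Pn; apply: contraNneq sD => ->; apply: complex_set0.
  by rewrite /face_monomial rmorph_prod (bigD1 x) //= mevalXU mul0r mulr0.
- move=> p q r /asboolP [c ->] /asboolP [e ->]; apply/asboolP.
  exists (fun i => p * c i + e i); rewrite mulr_sumr -big_split.
  by apply: eq_bigr => i _; rewrite mulrDl mulrA.
Qed.

HB.instance Definition _ D := isIdealr.Build _ (sr_ideal D) (sr_ideal_closed D).

Definition sr_ring (D : complex V) : comNzRingType := {ideal_quot (sr_ideal D)}.

End StanleyReisner.

Arguments sr_ideal k [V] D.

(* Main.v *)
(**
(i) => (ii).  Given a complex G on V with n vertices, take vertices x_v and y_v for v in V,
with faces {x_v | v in F} u {y_v | v in E} for F in G and E disjoint from F.  All facets have
n elements, {x_v, y_v} are the colour classes, and the h-vector is the f-vector of G.  Deleting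
x_v, or taking its link, gives complexes of the same shape for the deletion and the link of v
in G, whence vertex decomposability.

(iii) => (iv).  Let theta_j be the sum of the variables of colour j.  By Zariski's lemma a
maximal ideal P contains p_j(theta_j) for monic univariate p_j.  These p_j(theta_j) form a
regular sequence modulo the prime of each facet, and the exact sequences of a shelling carry
regularity to the Stanley-Reisner ring, so P contains a regular sequence of length d.  A regular
sequence in P gives a prime chain of the same length below P.  Conversely, from a prime chain or
a regular sequence of length n one gets n algebraically independent elements, and counting face
monomials of bounded degree gives n <= d.

(iv) => (i).  Modulo the theta_j the square of every variable vanishes, so the elements of the
irrelevant ideal act nilpotently on the Koszul homology of theta.  A regular sequence a of length
at least d in the irrelevant ideal then makes this homology vanish in positive degrees: a
nonzero class of degree i would produce, for each element of a divided out, a nonzero class of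
degree one more.  The squarefree part of the Koszul complex is a finite complex, whose Euler
characteristics are the h-numbers; they count the standard monomials of the quotient by theta
with respect to a monomial order.  These are squarefree and closed under divisors, so they form
a simplicial complex with f-vector h.
*)
From HB Require Import structures.
Require Import Defs.
From mathcomp Require Import all_boot all_order all_algebra.
From mathcomp Require classical_sets.
From mathcomp Require Import ring_quotient boolp mpoly zify ring.

Set Implicit Arguments.
Unset Strict Implicit.
Unset Printing Implicit Defensive.

Import GRing.Theory.

(** * Facets and dimension *)

Section Facets.
Variable V : finType.
Implicit Types (D : {set {set V}}) (F G : {set V}).

Lemma facet_face D F : F \in facets D -> F \in D.
Proof. by rewrite inE => /maxsetp. Qed.

Lemma facet_max D F G : F \in facets D -> G \in D -> F \subset G -> G = F.
Proof. by rewrite inE => /maxsetP [_ maxF] GD; apply: maxF. Qed.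

Lemma facet_above D F : F \in D -> exists2 G, G \in facets D & F \subset G.
Proof.
move=> FD; have [G maxG FG] := maxset_exists (P := fun G => G \in D) FD.
by exists G; rewrite ?inE.
Qed.

Lemma dimS_ge D F : F \in D -> #|F| <= dimS D.
Proof.
move=> /facet_above [G GD FG]; apply: leq_trans (subset_leq_card FG) _.
exact: (leq_bigmax_cond (F := fun A : {set V} => #|A|)).
Qed.

Lemma dimS_pure D F : pure D -> F \in facets D -> dimS D = #|F|.
Proof.
move=> pD FD; apply/eqP; rewrite eqn_leq.
apply/andP; split; last exact/dimS_ge/facet_face.
by apply/bigmax_leqP => G GD; rewrite (pD _ _ GD FD).
Qed.

Lemma dimS_attained D : set0 \in D -> exists2 F, F \in facets D & #|F| = dimS D.
Proof.
move=> /facet_above [G GD _]; have : 0 < #|facets D| by apply/card_gt0P; exists G.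
by move=> /(eq_bigmax_cond (fun A : {set V} => #|A|)) [F FD e]; exists F; rewrite ?e.
Qed.

End Facets.

(** * A balanced vertex decomposable complex with prescribed h-vector *)

Section Whisker.
Variable V : finType.
Implicit Types (U F : {set V}) (G : {set {set V}}) (A B : {set V * bool}).

Definition slice (b : bool) A : {set V} := [set v | (v, b) \in A].

Definition glue F U : {set V * bool} := [set p | p.1 \in if p.2 then F else U].

Lemma slice_glue b F U : slice b (glue F U) = if b then F else U.
Proof. by apply/setP=> v; rewrite !inE /=; case: b. Qed.

Lemma glue_slice A : glue (slice true A) (slice false A) = A.
Proof. by apply/setP=> -[v []]; rewrite !inE /= ?inE. Qed.

Lemma card_slices A : #|A| = #|slice true A| + #|slice false A|.
Proof.
rewrite -[A in LHS]glue_slice.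
move: (slice true A) (slice false A) => F U.
have -> : glue F U = [set (v, true) | v in F] :|: [set (v, false) | v in U].
  apply/setP=> -[v []]; rewrite !inE /=.
    apply/idP/orP => [vF|[/imsetP [w wF [->]] //|/imsetP [w _ [] //]]].
    by left; apply/imsetP; exists v.
  apply/idP/orP => [vF|[/imsetP [w _ [] //]|/imsetP [w wF [->]] //]].
  by right; apply/imsetP; exists v.
rewrite cardsU (_ : _ :&: _ = set0) ?cards0 ?subn0; last first.
  apply/setP=> p; rewrite !inE; apply/negP.
  by move=> /andP [/imsetP [v _ ->] /imsetP [w _]].
by rewrite !card_imset // => v w [].
Qed.

(* The faces are the sets {x_v | v in F} u {y_v | v in E} with F a face of G
   and E a subset of U \ F; x_v is (v, true) and y_v is (v, false). *)
Definition whisker U G : {set {set V * bool}} :=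
  [set A | [&& slice true A \in G, slice false A \subset U
             & [disjoint slice true A & slice false A]]].

Definition down_closed (W : finType) (D : {set {set W}}) : Prop :=
  forall s t : {set W}, s \subset t -> t \in D -> s \in D.

Lemma slice_sub b A B : A \subset B -> slice b A \subset slice b B.
Proof. by move=> /subsetP AB; apply/subsetP=> v; rewrite !inE => /AB. Qed.

Lemma whisker_closed U G : down_closed G -> down_closed (whisker U G).
Proof.
move=> cG A B AB; rewrite !inE => /and3P [B1 B0 dB]; apply/and3P; split.
- exact: cG (slice_sub _ AB) B1.
- exact: subset_trans (slice_sub _ AB) B0.
- exact: disjointWl (slice_sub _ AB) (disjointWr (slice_sub _ AB) dB).
Qed.

Lemma card_whisker U G A :
  G \subset powerset U -> A \in whisker U G -> #|A| <= #|U|.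
Proof.
move=> /subsetP GU; rewrite inE card_slices => /and3P [/GU]; rewrite inE.
move=> A1 A0 dA; apply: (@leq_trans #|slice true A :|: slice false A|).
  by rewrite cardsU disjoint_setI0 // cards0 subn0.
by rewrite subset_leq_card // subUset A1.
Qed.

(** The second slice of a face can always be enlarged to all of U outside the first slice, and the
    result has #|U| elements; conversely no face is larger than that. *)
Lemma facets_whisker U G A : G \subset powerset U ->
  (A \in facets (whisker U G)) = (A \in whisker U G) && (#|A| == #|U|).
Proof.
move=> GU; apply/idP/andP => [fA|[AW /eqP cA]].
  have AW := facet_face fA; split=> //.
  move: (AW); rewrite inE => /and3P [A1 A0 dA].
  have A1U : slice true A \subset U by have := subsetP GU _ A1; rewrite inE.
  rewrite -(facet_max (G := glue (slice true A) (U :\: slice true A)) fA).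
  - rewrite card_slices !slice_glue cardsD (setIidPr A1U) subnKC //.
    exact: subset_leq_card.
  - by rewrite inE !slice_glue A1 subsetDl -setI_eq0 setIDA setIC setDIl setDv setI0 eqxx.
  - apply/subsetP=> -[v b]; rewrite !inE /=; case: b => vA; rewrite ?inE //=.
    have v0 : v \in slice false A by rewrite inE.
    rewrite (subsetP A0) // andbT.
    by have := disjointFl dA v0; rewrite inE => ->.
rewrite inE; apply/maxsetP; split=> // B BW AB; apply/eqP.
by rewrite eq_sym eqEcard AB cA (card_whisker GU).
Qed.

Lemma whisker_pure U G : G \subset powerset U -> pure (whisker U G).
Proof.
by move=> GU A B; rewrite !facets_whisker // => /andP [_ /eqP ->] /andP [_ /eqP ->].
Qed.

Lemma whisker_top U G :
  G \subset powerset U -> set0 \in G -> glue set0 U \in facets (whisker U G).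
Proof.
move=> GU G0; rewrite facets_whisker // inE card_slices !slice_glue G0 subxx.
by rewrite cards0 eqxx -setI_eq0 set0I eqxx.
Qed.

Lemma dimS_whisker U G :
  G \subset powerset U -> set0 \in G -> dimS (whisker U G) = #|U|.
Proof.
move=> GU G0; have fT := whisker_top GU G0.
rewrite (dimS_pure (whisker_pure GU) fT).
by move: fT; rewrite facets_whisker // => /andP [_ /eqP].
Qed.

Lemma slice_true_setU1 v A : slice true ((v, true) |: A) = v |: slice true A.
Proof. by apply/setP=> w; rewrite !inE xpair_eqE andbT. Qed.

Lemma slice_false_setU1 v A : slice false ((v, true) |: A) = slice false A.
Proof. by apply/setP=> w; rewrite !inE xpair_eqE andbF. Qed.

Lemma deletion_whisker U G v :
  deletion (whisker U G) (v, true) = whisker U (deletion G v).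
Proof. by apply/setP=> A; rewrite !inE -!andbA; do !bool_congr. Qed.

(** A face containing x_v omits y_v, so both copies of v disappear from the link; this is why U
    shrinks to [U :\ v]. *)
Lemma link_whisker U G v : down_closed G ->
  link (whisker U G) (v, true) = whisker (U :\ v) (link G v).
Proof.
move=> cG; apply/setP=> A; rewrite !inE slice_true_setU1 slice_false_setU1.
have -> : [disjoint v |: slice true A & slice false A] =
    (v \notin slice false A) && [disjoint slice true A & slice false A].
  by rewrite -setI_eq0 setIUl setU_eq0 !setI_eq0 disjoints1.
rewrite subsetD1 !inE.
case: (boolP (v |: slice true A \in G)) => [vG|_]; last by rewrite !(andbF, andFb).
have -> /= : slice true A \in G by apply: cG vG; apply: subsetUr.
case: ((v, true) \in A); case: ((v, false) \in A) => //=;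
  rewrite ?andbT ?andbF //.
by case: (_ \subset _); case: [disjoint _ & _].
Qed.

(** Induction on the number of faces of G: for a vertex v of G, the deletion and the link of x_v are
    whiskers over families that have lost the face {v}. When G has only the empty face, the set of
    all y_v is the only facet. U varies in the induction because the link changes it. *)
Lemma whisker_vd U G : G \subset powerset U -> down_closed G -> set0 \in G ->
  vertex_decomposable (whisker U G).
Proof.
elim: {G}_.+1 {-2}G (ltnSn #|G|) U => // n IHn G cardG U GU cG G0.
have [[F FG F0]|] := pselect (exists2 F, F \in G & F != set0); last first.
  move=> nG; apply: Vd_simplex.
  have G1 F : F \in G -> F = set0.
    by move=> FG; apply: contra_notP nG => /eqP; exists F.
  rewrite /simplex (_ : facets _ = [set glue set0 U]) ?cards1 //.
  apply/setP=> A; rewrite [RHS]inE; apply/idP/eqP => [|->]; last first.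
    exact: whisker_top.
  rewrite facets_whisker // inE => /andP [/and3P [/G1 A1 A0 _]].
  rewrite card_slices A1 cards0 add0n => /eqP cA.
  by rewrite -(glue_slice A) A1; congr glue; apply/eqP; rewrite eqEcard A0 cA /=.
have [v vF] := set0Pn _ F0.
have vG : [set v] \in G by apply: cG FG; rewrite sub1set.
apply: (@Vd_vertex _ _ (v, true)).
- exact: whisker_pure.
- have s1 : slice true [set (v, true)] = [set v].
    by apply/setP=> w; rewrite !inE xpair_eqE andbT.
  have s0 : slice false [set (v, true)] = set0.
    by apply/setP=> w; rewrite !inE xpair_eqE andbF.
  by rewrite inE s1 s0 vG sub0set -setI_eq0 setI0 eqxx.
- rewrite deletion_whisker; apply: IHn.
  + apply: leq_trans (ltnSE cardG); apply/proper_card/properP.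
    split; first by apply/subsetP=> A; rewrite inE => /andP [].
    by exists [set v]; rewrite // !inE eqxx andbF.
  + by apply/subsetP=> A; rewrite inE => /andP [/(subsetP GU)].
  + move=> A B AB; rewrite !inE => /andP [/(cG _ _ AB) ->].
    by apply: contraNN => /(subsetP AB).
  + by rewrite !inE G0.
- rewrite link_whisker //; apply: IHn.
  + apply: leq_trans (ltnSE cardG); apply/proper_card/properP.
    split; first by apply/subsetP=> A; rewrite inE => /andP [].
    by exists [set v]; rewrite // !inE eqxx andbF.
  + apply/subsetP=> A; rewrite !inE subsetD1 => /and3P [/(subsetP GU)].
    by rewrite inE => -> ->.
  + move=> A B AB; rewrite !inE => /and3P [/(cG _ _ AB) -> vB vBG].
    rewrite (contraNN (subsetP AB v) vB) /=.
    exact: cG (setUS _ AB) vBG.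
  + by rewrite !inE setU0 G0 vG.
Qed.

End Whisker.

(** * Trailing zeros, and the f- and h-numbers of whisker complexes *)

Lemma trim_nth (s : seq int) i : nth 0%R (trim s) i = nth 0%R s i.
Proof.
elim: s i => [|x s IHs] [|i] //=; case: ifP => [/andP [/eqP x0 /nilP t0]|_] //=.
by rewrite -IHs t0 nth_nil.
Qed.

(** As m has no zero entry, the zeros of s start exactly where m ends. *)
Lemma trim_eq (s : seq int) (m : seq nat) : all (fun i => 0 < i) m ->
  (forall i, nth 0%R s i = nth 0 m i) -> trim s = map Posz m.
Proof.
elim: s m => [|x s IHs] [|a m] //=.
- by move=> /andP [a_gt0 _] /(_ 0) /= [a0]; rewrite -a0 in a_gt0.
- move=> _ sm; rewrite (IHs [::]) //= => [|i]; first by move: (sm 0) => /= ->; rewrite eqxx.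
  by have := sm i.+1; rewrite /= !nth_nil.
- move=> /andP [a_gt0 m_gt0] sm; rewrite (IHs m) // => [|i]; last exact: (sm i.+1).
  by move: (sm 0) => /= ->; case: ifP => // /andP [/eqP [a0]]; rewrite a0 in a_gt0.
Qed.

Lemma fnum_large (V : finType) (D : {set {set V}}) i : dimS D < i -> fnum D i = 0.
Proof.
move=> Di; apply/eqP; rewrite cards_eq0; apply/eqP/setP=> F; rewrite !inE.
apply/negP => /andP [/dimS_ge FD /eqP cF]; move: Di; rewrite -cF.
by rewrite ltnNge FD.
Qed.

Lemma nth_f_vector (V : finType) (D : {set {set V}}) i :
  nth 0 (f_vector D) i = fnum D i.
Proof.
have [iD|Di] := ltnP i (dimS D).+1; first by rewrite nth_mkseq.
by rewrite nth_default ?size_mkseq // fnum_large.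
Qed.

Lemma trinomial_revision a b c : c <= b <= a ->
  'C(a - c, b - c) * 'C(a, c) = 'C(a, b) * 'C(b, c).
Proof.
move=> /andP [cb ba]; have ca := leq_trans cb ba.
have d : (a - c) - (b - c) = a - b by lia.
have bc : b - c <= a - c by lia.
have := bin_fact ca; have := bin_fact bc; have := bin_fact ba; have := bin_fact cb.
rewrite d => e1 e2 e3 e4.
have p0 : 0 < c`! * (b - c)`! * (a - b)`! by rewrite !muln_gt0 !fact_gt0.
apply/eqP; rewrite -(eqn_pmul2r p0); apply/eqP.
transitivity (a`!); first by rewrite -e4 -e3; ring.
by rewrite -e2 -e1; ring.
Qed.

Section AlternatingSum.
Local Open Scope ring_scope.

Lemma alternating_bin b :
  \sum_(c < b.+1) (-1) ^+ (b - c) * ('C(b, c))%:Z = (b == 0%N)%:Z :> int.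
Proof.
transitivity ((-1 + 1) ^+ b : int); last by rewrite addNr expr0n natz.
rewrite exprDn; apply: eq_bigr => c _.
by rewrite expr1n mulr1 -[in RHS]mulr_natr natz.
Qed.

End AlternatingSum.

Section WhiskerNumbers.
Variable V : finType.
Implicit Types (F : {set V}) (G : {set {set V}}).

(** Once the first slice F is fixed, the second is any set of i - #|F| elements outside F. *)
Lemma fnum_whisker G i : fnum (whisker [set: V] G) i =
  \sum_(F in G | #|F| <= i) 'C(#|V| - #|F|, i - #|F|).
Proof.
rewrite /fnum -sum1_card.
rewrite (partition_big (slice true) (fun F => (F \in G) && (#|F| <= i))) /=; last first.
  move=> A; rewrite !inE => /andP [/and3P [-> _ _] /eqP <-].
  by rewrite card_slices leq_addr.
apply: eq_bigr => F /andP [FG Fi].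
rewrite sum1dep_card.
transitivity #|[set E : {set V} | E \subset ~: F & #|E| == i - #|F|]|; last first.
  by rewrite cards_draws cardsCs setCK.
rewrite -(card_in_imset (f := glue F)) => [|E E' _ _ /(congr1 (slice false))]; last first.
  by rewrite !slice_glue.
apply: eq_card => A; rewrite inE; apply/idP/imsetP.
  rewrite !inE => /andP [/andP [/and3P [_ _ dA] /eqP cA] /eqP AF].
  exists (slice false A); last by rewrite -AF glue_slice.
  rewrite inE -disjoints_subset disjoint_sym -AF dA /=.
  by rewrite -cA card_slices addKn.
case=> E; rewrite inE => /andP [EF /eqP cE] ->.
rewrite !inE card_slices !slice_glue FG subsetT cE eqxx subnKC // eqxx andbT /= andbT.
by rewrite disjoint_sym disjoints_subset.
Qed.

Local Open Scope ring_scope.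

(** After exchanging the sums, a face of size f contributes, by trinomial revision, 'C(#|V| - f, j -
    f) times the alternating sum of the binomials of row j - f. That sum vanishes unless f = j, so
    exactly the faces of size j are counted. *)
Lemma hnum_whisker G j : (j <= #|V|)%N -> set0 \in G ->
  hnum (whisker [set: V] G) j = (fnum G j)%:Z.
Proof.
move=> jV G0; rewrite /hnum dimS_whisker ?powersetT ?subsetT // cardsT.
under eq_bigr => i _ do
  rewrite fnum_whisker big_distrr /= -natz raddf_sum /= big_distrr /=.
under eq_bigr => i _ do rewrite big_mkcondr /=.
rewrite exchange_big /=.
transitivity (\sum_(F in G) (#|F| == j)%:Z); last first.
  rewrite /fnum -sum1_card -natz raddf_sum /= big_mkcond [RHS]big_mkcond.
  apply: eq_bigr => F _; rewrite inE; case: (F \in G) => //=.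
  by case: eqP; rewrite ?mulr1n.
apply: eq_bigr => F _; set f := #|F|.
have fV : (f <= #|V|)%N by apply: max_card.
have [fj|jf] := leqP f j; last first.
  rewrite big1 ?gtn_eqF // => i _; rewrite leqNgt (leq_trans _ jf) //=.
rewrite -(big_mkord xpredT (fun i : nat => if (f <= i)%N then
  (-1) ^+ (j - i) * ('C(#|V| - i, j - i) * 'C(#|V| - f, i - f))%:R else 0)) /=.
rewrite (@big_cat_nat _ _ _ f) ?leqW //= big_nat_cond big1 ?add0r; last first.
  by move=> i /andP [/andP [_ fi] _]; rewrite leqNgt fi.
rewrite -{1}[f]add0n big_addn subSn // big_mkord.
transitivity ('C(#|V| - f, j - f)%:Z *
   \sum_(c < (j - f).+1) (-1) ^+ (j - f - c) * ('C(j - f, c))%:Z : int); last first.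
  rewrite alternating_bin subn_eq0 eqn_leq fj /=.
  case: leqP => jf; rewrite ?mulr0 // mulr1.
  by rewrite (_ : (j - f = 0)%N) ?bin0 //; lia.
rewrite big_distrr; apply: eq_bigr => c _; rewrite leq_addl addnK.
have cj : (c <= j - f)%N by rewrite -ltnS.
have -> : (j - (c + f) = j - f - c)%N by lia.
have -> : (#|V| - (c + f) = #|V| - f - c)%N by lia.
rewrite trinomial_revision; last by lia.
by rewrite natz PoszM mulrCA.
Qed.

End WhiskerNumbers.

Lemma balanced_whisker (V : finType) (G : {set {set V}}) : set0 \in G ->
  balanced (whisker [set: V] G).
Proof.
move=> G0; rewrite /balanced dimS_whisker ?powersetT ?subsetT // cardsT.
exists (fun j => [set p | p.1 == enum_val j]); split.
- apply/setP=> p; rewrite inE; apply/bigcupP.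
  by exists (enum_rank p.1); rewrite // inE enum_rankK.
- move=> i j ij; rewrite -setI_eq0; apply/eqP/setP=> p; rewrite !inE.
  apply: contraNF ij => /andP [/eqP -> /eqP /enum_val_inj ->] //.
- move=> A j /facet_face; rewrite inE => /and3P [_ _ dA].
  apply/card_le1_eqP => -[v b] [w c]; rewrite !inE /=.
  move=> /andP [vA /eqP ev] /andP [wA /eqP ew]; subst v w; congr (_, _).
  have [] : enum_val j \in slice b A /\ enum_val j \in slice c A by rewrite !inE.
  by case: b vA; case: c wA => // _ _; [move=> a1 | move=> /[swap] a1];
    rewrite (disjointFr dA a1).
Qed.

Theorem f_vector_is_balanced_vd_h_vector (V : finType) (D : complex V) (m : seq nat) :
  all (fun i => 0 < i) m -> f_vector D = m ->
  exists (W : finType) (E : complex W),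
    [/\ balanced E, vertex_decomposable E & is_h_vector m E].
Proof.
move=> m_gt0 Dm; have D0 := complex_set0 D.
have sD : faces D \subset powerset [set: V] by rewrite powersetT subsetT.
have E0 : set0 \in whisker [set: V] D.
  by apply: whisker_closed (sub0set _) (facet_face (whisker_top sD D0)); apply: complex_sub.
exists _, (Complex E0 (whisker_closed (@complex_sub _ D))); split=> /=.
- exact: balanced_whisker.
- exact: whisker_vd sD (@complex_sub _ D) D0.
- apply: trim_eq => // i; rewrite -Dm nth_f_vector.
  have [iV|Vi] := ltnP i #|V|.+1.
    rewrite nth_mkseq ?hnum_whisker //.
    by rewrite (dimS_whisker sD D0) cardsT.
  rewrite nth_default ?size_mkseq ?(dimS_whisker sD D0) ?cardsT // fnum_large //.
  apply: leq_trans Vi; rewrite ltnS; apply/bigmax_leqP => F _; exact: max_card.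
Qed.

(** * Vertex decomposable complexes are shellable *)

Section Shelling.
Variable V : finType.
Implicit Types (D : {set {set V}}) (F G : {set V}) (v : V).

Lemma deletion_closed D v : down_closed D -> down_closed (deletion D v).
Proof.
move=> cD A B AB; rewrite !inE => /andP [/(cD _ _ AB) ->].
by apply: contraNN => /(subsetP AB).
Qed.

Lemma link_closed D v : down_closed D -> down_closed (link D v).
Proof.
move=> cD A B AB; rewrite !inE => /and3P [/(cD _ _ AB) -> vB vBD].
by rewrite (contraNN (subsetP AB v) vB) (cD _ _ (setUS [set v] AB) vBD).
Qed.

Lemma facets_link D v F : down_closed D ->
  (F \in facets (link D v)) = (v \notin F) && (v |: F \in facets D).
Proof.
move=> cD; apply/idP/andP => [fF|[vF fF]].
  have := facet_face fF; rewrite inE => /and3P [FD vF vFD]; split=> //.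
  rewrite inE; apply/maxsetP; split=> // G GD vFG.
  have vG : v \in G by apply: subsetP vFG _ (setU11 _ _).
  rewrite -(facet_max fF (G := G :\ v)) ?setD1K //.
    by rewrite !inE eqxx setD1K // GD (cD _ _ (subD1set G v) GD).
  by rewrite subsetD1 vF (subset_trans (subsetUr _ _) vFG).
rewrite inE; apply/maxsetP; split.
  by rewrite inE vF (facet_face fF) (cD _ _ (subsetUr _ _) (facet_face fF)).
move=> G; rewrite inE => /and3P [_ vG vGD] FG.
by rewrite -(setU1K vG) (facet_max fF vGD (setUS _ FG)) setU1K.
Qed.

Lemma facets_star D v F : down_closed D -> v \in F ->
  (F \in facets D) = (F :\ v \in facets (link D v)).
Proof. by move=> cD vF; rewrite facets_link // setD1K // !inE eqxx. Qed.

Lemma nth_star v (Fs : seq {set V}) i : i < size Fs ->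
  nth set0 [seq v |: F | F <- Fs] i = v |: nth set0 Fs i.
Proof. by move=> iF; rewrite (nth_map set0). Qed.

Lemma uniq_star D v (Fs : seq {set V}) :
  Fs =i facets (link D v) -> uniq Fs -> uniq [seq v |: F | F <- Fs].
Proof.
move=> mF uF; rewrite map_inj_in_uniq // => A B; rewrite !mF.
move=> /facet_face; rewrite inE => /and3P [_ vA _] /facet_face.
by rewrite inE => /and3P [_ vB _] AB; rewrite -(setU1K vA) AB setU1K.
Qed.

Lemma mem_star D v (Fs : seq {set V}) F : down_closed D ->
  Fs =i facets (link D v) ->
  (F \in [seq v |: G | G <- Fs]) = (v \in F) && (F \in facets D).
Proof.
move=> cD mF; apply/mapP/andP => [[G]|[vF FD]].
  by rewrite mF facets_link // => /andP [_ vGD] ->; rewrite setU11.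
by exists (F :\ v); rewrite ?setD1K // mF -facets_star.
Qed.

Lemma star_steps v (A B : {set V}) : v \notin A ->
  (v |: A) :\: (v |: B) = A :\: B.
Proof.
move=> vA; apply/setP=> w; rewrite !inE negb_or.
by case: eqP => [->|]; rewrite ?(negbTE vA) ?andbF.
Qed.

(** The facets avoiding v come first, in the order of the shelling of the deletion, followed by the
    facets v |: G with G in the order of the shelling of the link. *)
Lemma shelling_vertex D v (Fd Fl : seq {set V}) : down_closed D -> pure D ->
  pure (deletion D v) -> [set v] \in D ->
  shelling (deletion D v) Fd -> shelling (link D v) Fl -> exists Fs, shelling D Fs.
Proof.
move=> cD pD pdel vD [uFd mFd sFd] [uFl mFl sFl].
have avoid F : F \in facets D -> v \notin F -> F \in facets (deletion D v).
  move=> FD vF; rewrite inE; apply/maxsetP; split.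
    by rewrite inE vF facet_face.
  by move=> G /=; rewrite inE => /andP [GD _]; apply: (facet_max FD GD).
have vFl i : i < size Fl -> v \notin nth set0 Fl i.
  move=> iF; have := mem_nth set0 iF; rewrite mFl => /facet_face.
  by rewrite inE => /and3P [].
have uS := uniq_star mFl uFl; have mS := mem_star _ cD mFl.
have stepS i j : i < j < size Fl -> exists w l,
    [/\ w \in (v |: nth set0 Fl j) :\: (v |: nth set0 Fl i), l < j
      & (v |: nth set0 Fl j) :\: (v |: nth set0 Fl l) = [set w]].
  move=> /[dup] ij /sFl [w [l [wji lj e]]]; have /andP [_ jF] := ij.
  by exists w, l; split=> //; rewrite star_steps ?vFl.
(* If D is a cone with apex v, the facets of the deletion are not facets of D, and the shelling of
   the link, coned off, is already a shelling of D. *)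
have [[F0 F0D vF0]|coneD] := pselect (exists2 F, F \in facets D & v \notin F); last first.
  exists [seq v |: F | F <- Fl]; split=> //.
    move=> F; rewrite mS andb_idl // => FD; apply: contra_notT coneD => vF.
    by exists F.
  move=> i j; rewrite size_map => /[dup] ij /andP [lij jF].
  have [w [l [h lj e]]] := stepS _ _ ij.
  by exists w, l; rewrite !nth_star ?(ltn_trans lij jF) ?(ltn_trans lj jF).
(* F0 is a facet of both D and the deletion, so by purity the facets of the two have the same
   size. *)
have delD F : F \in facets (deletion D v) -> F \in facets D.
  move=> FdD; have cF := pdel _ _ FdD (avoid _ F0D vF0).
  have := facet_face FdD; rewrite inE => /andP [FD vF].
  have [G GD FG] := facet_above FD.
  suff -> : F = G by [].
  by apply/eqP; rewrite eqEcard FG cF (pD _ _ F0D GD) leqnn.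
exists (Fd ++ [seq v |: F | F <- Fl]); split.
- rewrite cat_uniq uFd uS andbT; apply/hasPn => F; rewrite mS mFd => /andP [vF _].
  by apply/negP => /facet_face; rewrite inE vF andbF.
- move=> F; rewrite mem_cat mS mFd; case: (boolP (v \in F)) => vF /=.
    by apply/orP/idP => [[/delD|]|FD] //; right.
  by rewrite orbF; apply/idP/idP => [/delD|/avoid] //; apply.
move=> i j /andP [ij]; rewrite size_cat size_map => jlt.
have [jd|dj] := ltnP j (size Fd).
  have [|w [l [wji lj e]]] := sFd i j; first by rewrite ij.
  by exists w, l; rewrite !nth_cat jd (ltn_trans ij jd) (ltn_trans lj jd).
have {}jlt : j - size Fd < size Fl by rewrite ltn_subLR.
have [id|di] := ltnP i (size Fd); last first.
  have [|w [l [wji lj e]]] := stepS (i - size Fd) (j - size Fd).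
    by rewrite jlt andbT ltn_sub2r // (leq_ltn_trans di).
  exists w, (size Fd + l); rewrite !nth_cat (leq_gtF dj) (leq_gtF di).
  rewrite (leq_gtF (leq_addr _ _)) addKn.
  have iF : i - size Fd < size Fl by rewrite (leq_ltn_trans _ jlt) // leq_sub2r // ltnW.
  rewrite !nth_star ?(ltn_trans lj jlt) //.
  by split=> //; rewrite -ltn_subRL.
(* The mixed case: facet i avoids v and facet j is v |: G. As G is a face of the deletion, it lies
   in a facet H listed earlier, and (v |: G) minus H is {v}. *)
have vi : v \notin nth set0 Fd i.
  have := mem_nth set0 id; rewrite mFd => /facet_face.
  by rewrite inE => /andP [].
have GD : nth set0 Fl (j - size Fd) \in deletion D v.
  have := mem_nth set0 jlt; rewrite mFl => /facet_face.
  by rewrite !inE => /and3P [-> ->].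
have [H HD GH] := facet_above GD.
have HFd : H \in Fd by rewrite mFd.
exists v, (index H Fd); rewrite !nth_cat index_mem HFd id nth_index // (leq_gtF dj).
rewrite nth_star //; split.
- by rewrite !inE eqxx vi.
- by apply: leq_trans dj; rewrite index_mem.
have vH : v \notin H by have := facet_face HD; rewrite inE => /andP [].
apply/setP=> w; rewrite !inE.
case: (eqVneq w v) => [->|_]; first by rewrite vH.
by apply/negP => /andP [/negP wH /(subsetP GH)].
Qed.

Lemma vertex_decomposable_pure D : vertex_decomposable D -> pure D.
Proof.
case=> [E|E v pE _ _ _] //.
by move=> /eqP /cards1P [F eF] A B; rewrite eF !inE => /eqP -> /eqP ->.
Qed.

Lemma vertex_decomposable_shelling D :
  down_closed D -> vertex_decomposable D -> exists Fs, shelling D Fs.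
Proof.
move=> cD vdD; elim: vdD cD => {D} [D /eqP /cards1P [F eF] _|].
  exists [:: F]; split=> // [A|i [|j]]; first by rewrite eF !inE.
    by [].
  by rewrite /= andbF.
move=> D v pD vD vdd IHd vdl IHl cD.
have [Fd sd] := IHd (deletion_closed cD).
have [Fl sl] := IHl (link_closed cD).
exact: shelling_vertex (vertex_decomposable_pure vdd) vD sd sl.
Qed.

End Shelling.

(** * Zariski's lemma *)

Section SimpleExtension.
Local Open Scope ring_scope.
Variables (F K : fieldType) (iota : {rmorphism F -> K}) (b : K).

Definition poly_eval : {poly F} -> K :=
  horner_morph (fun c : F => mulrC b (iota c)).
HB.instance Definition _ := GRing.RMorphism.on poly_eval.

Definition adjoin : {pred K} :=
  [pred x | `[< exists p q, poly_eval q != 0 /\ x = poly_eval p / poly_eval q >]].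

Lemma adjoin_divring_closed : divring_closed adjoin.
Proof.
split.
- apply/asboolP; exists 1, 1; rewrite rmorph1 divr1; split=> //; exact: oner_neq0.
- move=> x y /asboolP [p [q [q0 ->]]] /asboolP [r [s [s0 ->]]]; apply/asboolP.
  exists (p * s - r * q), (q * s); rewrite rmorphB !rmorphM mulf_neq0 //; split=> //.
  by field; rewrite q0 s0.
- move=> x y /asboolP [p [q [q0 ->]]] /asboolP [r [s [s0 ->]]]; apply/asboolP.
  have [r0|r0] := eqVneq (poly_eval r) 0.
    by exists 0, 1; rewrite r0 mul0r invr0 mulr0 rmorph0 rmorph1 mul0r oner_neq0.
  exists (p * s), (q * r); rewrite !rmorphM mulf_neq0 //; split=> //.
  by field; rewrite q0 s0 r0.
Qed.

HB.instance Definition _ := GRing.isDivringClosed.Build K adjoin adjoin_divring_closed.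

(** F(b) as a field type of its own, which can take the place of the base field in the induction of
    [zariski]. *)
Inductive adjoined : predArgType := Adjoined x of x \in adjoin.
Definition adjoined_val (x : adjoined) : K := let: Adjoined y _ := x in y.
HB.instance Definition _ := [isSub of adjoined for adjoined_val].
HB.instance Definition _ := [Choice of adjoined by <:].
HB.instance Definition _ := [SubChoice_isSubIntegralDomain of adjoined by <:].
HB.instance Definition _ := [SubIntegralDomain_isSubField of adjoined by <:].

Definition adjoined_embed : adjoined -> K := val.
HB.instance Definition _ := GRing.RMorphism.on adjoined_embed.

End SimpleExtension.

Section Zariski.
Local Open Scope ring_scope.

Lemma integral_exp (R K : comNzRingType) (f : {rmorphism R -> K}) x n :
  integralOver f x -> integralOver f (x ^+ n).
Proof.
move=> fx; elim: n => [|n IHn]; first by rewrite expr0; apply: integral1.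
by rewrite exprS; apply: integral_mul.
Qed.

(** Multiplying the equation of x by c ^+ m gives a monic equation of c * x with coefficients c ^+
    (m - i) * p[_i. For i < m these contain the factor c * p]_i, so they are integral, and
    integrality is transitive. *)
Lemma integral_scale (R : comNzRingType) (K : fieldType) (f : {rmorphism R -> K})
    (p : {poly K}) c x : p \is monic -> root p x -> integralOver f c ->
  (forall i, integralOver f (c * p`_i)) -> integralOver f (c * x).
Proof.
move=> mp px fc fp; set m := (size p).-1.
have sp : size p = m.+1 by rewrite polySpred ?monic_neq0.
have pm : p`_m = 1 by apply: (monicP mp).
pose q := \poly_(i < m.+1) (c ^+ (m - i) * p`_i).
have qm : q`_m = 1 by rewrite coef_poly ltnSn subnn mul1r.
have sq : size q = m.+1 by rewrite size_poly_eq // subnn mul1r pm oner_neq0.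
apply: (@integral_root_monic _ _ f _ q).
- by rewrite monicE lead_coefE sq qm.
- rewrite /root horner_poly (_ : \sum_(i < _) _ = c ^+ m * p.[x]).
    by rewrite (rootP px) mulr0.
  rewrite horner_coef sp big_distrr; apply: eq_bigr => i _ /=.
  have im : (i <= m)%N by rewrite -ltnS.
  have -> : c ^+ m = c ^+ (m - i) * c ^+ i by rewrite -exprD subnK.
  by rewrite exprMn; ring.
- apply/integral_poly => i; rewrite coef_poly; case: ltnP => [|_]; last exact: integral0.
  rewrite ltnS leq_eqVlt => /predU1P [->|im].
    by rewrite pm subnn mul1r; apply: integral1.
  rewrite -subnSK // exprSr -mulrA; apply: integral_mul; first exact: integral_exp.
  exact: fp.
Qed.

Variables (F K : fieldType) (iota : {rmorphism F -> K}) (b : K).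
Hypothesis b_trans : ~ algebraicOver iota b.

Local Notation ev := (poly_eval iota b).

Lemma poly_eval_eq0 p : ev p = 0 -> p = 0.
Proof.
move=> p0; apply: contra_notP b_trans => /eqP pn0; exists p => //.
exact/rootP.
Qed.

Lemma integral_poly_eval p : integralOver ev (ev p).
Proof. exact: integral_id. Qed.

(** A common denominator of the coefficients, collected one coefficient at a time. *)
Lemma adjoined_clear (p : {poly adjoined iota b}) :
  exists2 l, ev l != 0 & forall i, exists c, ev l * val p`_i = ev c.
Proof.
elim/poly_ind: p => [|p [u uu] [l l0 lp]].
  by exists 1 => [|i]; [rewrite rmorph1 oner_neq0 | exists 0; rewrite coef0 !rmorph0 mulr0].
have /asboolP [r [s [s0 ue]]] := uu.
exists (l * s) => [|[|i]]; first by rewrite rmorphM mulf_neq0.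
  exists (l * r); rewrite coefD coefMX coefC /= add0r ue !rmorphM.
  by field.
rewrite coefD coefMX coefC /= addr0; have [c ce] := lp i.
by exists (s * c); rewrite [ev (s * c)]rmorphM [ev (l * s)]rmorphM /= -ce mulrCA mulrA.
Qed.

Lemma algebraic_adjoined_integral x :
  algebraicOver (adjoined_embed (iota := iota) (b := b)) x ->
  exists2 l, ev l != 0 & integralOver ev (ev l * x).
Proof.
move=> /integral_algebraic [p mp px]; have [l l0 lp] := adjoined_clear p.
exists l => //; apply: integral_scale px _ _ => [||i].
- exact: monic_map.
- exact: integral_poly_eval.
- by have [c ce] := lp i; rewrite coef_map ce; apply: integral_poly_eval.
Qed.

(** The polynomial g = 1 + 'X * f is nonconstant and coprime to f. If some f ^+ N / g were integral
    over F[b], its equation would make g divide a power of f. *)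
Lemma integral_closure_poly_eval f : ev f != 0 ->
  ~ (forall x, exists N, integralOver ev (ev f ^+ N * x)).
Proof.
move=> f0 all_int; pose g := 1 + 'X * f.
have fn0 : f != 0 by apply: contraNneq f0 => ->; rewrite rmorph0.
have sXf : size ('X * f) = (size f).+1 by rewrite mulrC size_mulX.
have f_gt0 : (0 < size f)%N by rewrite size_poly_gt0.
have sg : size g = (size f).+1 by rewrite /g addrC size_polyDl ?size_poly1 sXf.
have gn0 : g != 0 by rewrite -size_poly_gt0 sg.
have evg : ev g != 0 by apply: contra_neq gn0; apply: poly_eval_eq0.
have [N [q mq qr]] := all_int (ev g)^-1.
set m := (size q).-1.
have sq : size q = m.+1 by rewrite polySpred ?monic_neq0.
have qm : q`_m = 1 by apply: (monicP mq).
(* The integral equation times g ^+ m; as b is transcendental it holds between polynomials. All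
   terms but the last, f ^+ (N * m), are divisible by g. *)
have : \sum_(i < m.+1) q`_i * f ^+ (N * i) * g ^+ (m - i) = 0.
  apply: poly_eval_eq0; rewrite raddf_sum.
  rewrite (_ : \sum_(i < _) _ = ev g ^+ m * (map_poly ev q).[ev f ^+ N * (ev g)^-1]).
    by rewrite (rootP qr) mulr0.
  rewrite horner_coef size_map_poly_id0 ?(monicP mq) ?rmorph1 ?oner_neq0 //.
  rewrite sq big_distrr; apply: eq_bigr => i _ /=; rewrite coef_map.
  have im : (i <= m)%N by rewrite -ltnS.
  rewrite !(rmorphM, rmorphXn) exprMn -exprM exprVn.
  have -> : ev g ^+ m = ev g ^+ (m - i) * ev g ^+ i by rewrite -exprD subnK.
  by field; rewrite expf_neq0.
rewrite big_ord_recr /= qm mul1r subnn mulr1 => /eqP.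
rewrite addr_eq0 => /eqP sum_eq.
have gf : g %| f ^+ (N * m).
  rewrite -dvdpNr -sum_eq; apply: (big_ind (fun u => g %| u)) => [|u v|i _]; first exact: dvdp0.
    exact: dvdp_add.
  by apply: dvdp_mull; rewrite -subnSK // exprS dvdp_mulIl.
have cgf : coprimep g f.
  apply/Bezout_coprimepP; exists (1, - 'X); rewrite /= mul1r /g mulNr addrK.
  exact: eqpxx.
move: (coprimep_dvdl gf (coprimep_expr (N * m) cgf)).
by rewrite coprimepp sg; case: (size f) f_gt0.
Qed.

End Zariski.

(* b is transcendental over F by contradiction; then K is algebraic over F(b),
   hence integral over F[b] localized at a single element, which is absurd. *)
Lemma zariski (F K : fieldType) (iota : {rmorphism F -> K}) (s : seq K) :
    (forall Q : K -> Prop, (forall x y, Q x -> Q y -> Q (x - y)%R) ->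
      (forall x y, Q x -> Q y -> Q (x * y)%R) -> (forall c, Q (iota c)) ->
      (forall x, x \in s -> Q x) -> forall x, Q x) ->
  forall x, algebraicOver iota x.
Proof.
(* The hypothesis on Q says that K is generated as a ring by F and s. F varies in the induction
   because one generator b is moved into the base field. *)
move e : (size s) => n; elim: n => [|n IHn] in F iota s e *.
  move=> gen; apply: gen.
  - exact: algebraic_sub.
  - exact: algebraic_mul.
  - exact: algebraic_id.
  - by case: s e.
move=> gen.
have [alg|] := pselect (forall x, x \in s -> algebraicOver iota x).
  apply: gen => //.
  - exact: algebraic_sub.
  - exact: algebraic_mul.
  - exact: algebraic_id.
move=> /existsNP [b] /not_implyP [bs b_trans].
have alg : forall x, algebraicOver (adjoined_embed (iota := iota) (b := b)) x.
  apply: (IHn _ _ (rem b s)); first by rewrite size_rem // e.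
  move=> Q Qsub Qmul Qadj Qs.
  have Qev p : Q ((poly_eval iota b) p).
    have pP : (poly_eval iota b) p \in adjoin iota b.
      by apply/asboolP; exists p, 1%R; rewrite rmorph1 divr1 oner_neq0.
    exact: (Qadj (Adjoined pP)).
  apply: gen => // [c|x xs].
    by have := Qev c%:P%R; rewrite /poly_eval horner_morphC.
  move: xs; rewrite (perm_mem (perm_to_rem bs)) inE => /predU1P [->|]; last exact: Qs.
  by have := Qev 'X%R; rewrite /poly_eval horner_morphX.
(* The product of the denominators of all generators serves every one of them, and hence, up to
   powers, every element of K. *)
have [f f0 fs] : exists2 f, poly_eval iota b f != 0%R &
    forall x, x \in s ->
      exists N, integralOver (poly_eval iota b) (poly_eval iota b f ^+ N * x)%R.
  elim: s {e gen bs} => [|y s [f f0 fs]].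
    by exists 1%R; rewrite // rmorph1 oner_neq0.
  have [l l0 ly] := algebraic_adjoined_integral (alg y).
  exists (l * f)%R; first by rewrite rmorphM mulf_neq0.
  move=> x; rewrite inE => /predU1P [->|/fs [N fNx]].
    exists 1%N; rewrite expr1 rmorphM mulrAC mulrC.
    by apply: integral_mul => //; apply: integral_poly_eval.
  exists N; rewrite rmorphM exprMn -mulrA.
  by apply: integral_mul => //; apply/integral_exp/integral_poly_eval.
case: (integral_closure_poly_eval b_trans f0).
have int_f N : integralOver (poly_eval iota b) (poly_eval iota b f ^+ N)%R.
  exact/integral_exp/integral_poly_eval.
apply: gen => // [x y [N fx] [M fy]|x y [N fx] [M fy]|c].
- exists (N + M)%N; rewrite mulrBr; apply: integral_sub.
    by rewrite exprD mulrAC mulrC; apply: integral_mul.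
  by rewrite exprD -mulrA; apply: integral_mul.
- by exists (N + M)%N; rewrite exprD mulrACA; apply: integral_mul.
- exists 0%N; rewrite expr0 mul1r.
  by have := integral_poly_eval iota b c%:P%R; rewrite /poly_eval horner_morphC.
Qed.

(** * Regular sequences and prime chains *)

Section Ideals.
Local Open Scope ring_scope.
Variable A : comNzRingType.
Implicit Types (I J : A -> Prop) (a g x y : A) (s : seq A).

(** Unlike [idealr_closed], this admits the unit ideal, so that it is preserved by adding
    generators. *)
Definition ideal J : Prop :=
  [/\ J 0, forall x y, J x -> J y -> J (x + y) & forall a x, J x -> J (a * x)].

Lemma ideal0 J : ideal J -> J 0. Proof. by case. Qed.

Lemma idealD J x y : ideal J -> J x -> J y -> J (x + y).
Proof. by case=> _ + _; apply. Qed.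

Lemma idealM J a x : ideal J -> J x -> J (a * x).
Proof. by case=> _ _; apply. Qed.

Lemma idealMl J a x : ideal J -> J x -> J (x * a).
Proof. by rewrite mulrC; apply: idealM. Qed.

Lemma idealN J x : ideal J -> J x -> J (- x).
Proof. by move=> iJ Jx; rewrite -mulN1r; apply: idealM. Qed.

Lemma idealB J x y : ideal J -> J x -> J y -> J (x - y).
Proof. by move=> iJ Jx Jy; apply: idealD => //; apply: idealN. Qed.

Lemma ideal_sum J (T : Type) (r : seq T) (P : pred T) (f : T -> A) :
  ideal J -> (forall i, P i -> J (f i)) -> J (\sum_(i <- r | P i) f i).
Proof. by move=> iJ Jf; apply: big_ind => //; case: iJ. Qed.

Lemma ideal_congr J x y : ideal J -> J (x - y) -> J y -> J x.
Proof. by move=> iJ Jxy Jy; rewrite -(subrK y x); apply: idealD. Qed.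

Definition extend J a : A -> Prop := fun x => exists c, J (x - c * a).

Lemma ideal_extend J a : ideal J -> ideal (extend J a).
Proof.
move=> iJ; split.
- by exists 0; rewrite mul0r subr0; apply: ideal0.
- move=> x y [c Jc] [d Jd]; exists (c + d).
  by rewrite mulrDl opprD addrACA; apply: idealD.
- by move=> b x [c Jc]; exists (b * c); rewrite -mulrA -mulrBr; apply: idealM.
Qed.

Lemma extend_sub J a x : ideal J -> J x -> extend J a x.
Proof. by exists 0; rewrite mul0r subr0. Qed.

Lemma extend_gen J a : ideal J -> extend J a a.
Proof. by exists 1; rewrite mul1r subrr; apply: ideal0. Qed.

Lemma extend_min J J' a x : ideal J' -> (forall y, J y -> J' y) -> J' a ->
  extend J a x -> J' x.
Proof. by move=> iJ' JJ' J'a [c /JJ' Jc]; apply: ideal_congr Jc _ => //; apply: idealM. Qed.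

Lemma extendC J a b : ideal J -> extend (extend J a) b = extend (extend J b) a.
Proof.
move=> iJ; apply/funext => x; apply/propext.
by split=> -[c [d J1]]; exists d, c; rewrite addrAC.
Qed.

Definition nonzerodiv J a : Prop := forall x, J (a * x) -> J x.

(** Properness is not asked for: modulo the unit ideal every sequence qualifies, which starts the
    induction along a shelling. *)
Fixpoint weakly_regular J s : Prop :=
  if s is a :: s' then nonzerodiv J a /\ weakly_regular (extend J a) s' else True.

(* Both regular sequences and prime chains give rise to such flags. *)
Fixpoint regular_flag J s : Prop :=
  if s is a :: s' then nonzerodiv J a /\ exists J',
    [/\ ideal J', forall x, J x -> J' x, J' a & regular_flag J' s']
  else ~ J 1.

Lemma weakly_regular_flag J s : ideal J -> weakly_regular J s ->
  ~ foldl extend J s 1 -> regular_flag J s.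
Proof.
elim: s J => //= a s IHs J iJ [ra rs] s1; split=> //; exists (extend J a); split.
- exact: ideal_extend.
- by move=> x; apply: extend_sub.
- exact: extend_gen.
- by apply: IHs => //; apply: ideal_extend.
Qed.

Lemma ideal_foldl_extend J s : ideal J -> ideal (foldl extend J s).
Proof. by elim: s J => //= a s IHs J iJ; apply/IHs/ideal_extend. Qed.

Lemma foldl_extend_min J J' s x : ideal J' -> (forall y, J y -> J' y) ->
  (forall a, a \in s -> J' a) -> foldl extend J s x -> J' x.
Proof.
move=> iJ'; elim: s J x => [|a s IHs] J x JJ' sJ' /=; first exact: JJ'.
apply: IHs => [y|b bs]; last by apply: sJ'; rewrite inE bs orbT.
by apply: (extend_min iJ' JJ'); apply: sJ'; rewrite inE eqxx.
Qed.

Lemma foldl_extend_sub J s x : ideal J -> J x -> foldl extend J s x.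
Proof.
by elim: s J => //= a s IHs J iJ Jx; apply: IHs; [apply: ideal_extend | apply: extend_sub].
Qed.

Lemma foldl_extend_mem J s a : ideal J -> a \in s -> foldl extend J s a.
Proof.
elim: s J => //= b s IHs J iJ; have iJb := ideal_extend b iJ.
rewrite inE => /predU1P [->|]; last exact: IHs.
by apply: foldl_extend_sub => //; apply: extend_gen.
Qed.

(* The short exact sequence 0 -> A/J -> A/I -> A/(I + g) -> 0, the first map
   being multiplication by g, where J = (I : g). *)
Lemma weakly_regular_colon I J g s : ideal I -> ideal J ->
  (forall x, I (g * x) <-> J x) ->
  weakly_regular J s -> weakly_regular (extend I g) s -> weakly_regular I s.
Proof.
elim: s I J => //= a s IHs I J iI iJ IJ [raJ rsJ] [raI rsI].
have raI0 : nonzerodiv I a.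
  move=> x Iax; have [|c Ic] := raI x; first exact: extend_sub.
  apply: (ideal_congr iI Ic); rewrite mulrC; apply/IJ/raJ/IJ.
  rewrite mulrCA [g * c]mulrC -[X in I X]opprK -mulrN; apply: idealN => //.
  have -> : a * - (c * g) = a * (x - c * g) - a * x by ring.
  by apply: idealB => //; apply: idealM.
(* The colon relation survives adding a: if g * x = c * a modulo I, regularity of a modulo I + (g)
   gives c = d * g modulo I, and then x - d * a lies in J. *)
split=> //; apply: (IHs _ (extend J a)) => //; try exact: ideal_extend.
  move=> x; split=> [[c Ic]|[c /IJ Jc]].
    have [|d Id] := raI c.
      exists x; rewrite -(opprK (_ - _)) opprB; apply: idealN => //.
      by rewrite [x * g]mulrC [a * c]mulrC.
    exists d; apply/IJ.
    have -> : g * (x - d * a) = (g * x - c * a) + a * (c - d * g) by ring.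
    by apply: idealD => //; apply: idealM.
  by exists (g * c); move: Jc; rewrite mulrBr mulrA.
by rewrite extendC.
Qed.

End Ideals.

(** * Bounding the length of regular flags by counting monomials *)

Section Counting.
Local Open Scope ring_scope.
Variables (k : fieldType) (n : nat) (b : nat).
Local Notation S := {mpoly k[n]}.
Implicit Types (J : S -> Prop) (s : seq S) (c : seq nat -> k).

(* The coefficients are indexed by the lists of exponents, all below b. *)
Fixpoint power_comb s c : S :=
  if s is a :: s' then \sum_(i < b) a ^+ i * power_comb s' (fun l => c (val i :: l))
  else (c [::])%:MP.

Lemma power_comb0 s c : (forall l, size l = size s -> all (gtn b) l -> c l = 0) ->
  power_comb s c = 0.
Proof.
elim: s c => [|a s IHs] c c0 /=; first by rewrite c0 // mpolyC0.
rewrite big1 // => i _; rewrite IHs ?mulr0 // => l sl al.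
by apply: c0; rewrite /= ?sl ?ltn_ord.
Qed.

Lemma power_comb_sum (T : finType) s (u : T -> k) (c : T -> seq nat -> k) :
  power_comb s (fun l => \sum_t u t * c t l) = \sum_t u t *: power_comb s (c t).
Proof.
elim: s c => [|a s IHs] c /=.
  by rewrite raddf_sum; apply: eq_bigr => t _; rewrite -mul_mpolyC -mpolyCM.
under eq_bigr => i _ do rewrite IHs mulr_sumr.
rewrite exchange_big; apply: eq_bigr => t _; rewrite scaler_sumr.
by apply: eq_bigr => i _; rewrite scalerAr.
Qed.

Definition degree_le (e : nat) (p : S) := forall m, m \in msupp p -> (mdeg m <= e)%N.

Lemma degree_le_sum (T : Type) (r : seq T) (P : pred T) (f : T -> S) e :
  (forall i, P i -> degree_le e (f i)) -> degree_le e (\sum_(i <- r | P i) f i).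
Proof.
move=> df; apply: (big_ind (degree_le e)) => // [m|p q dp dq m].
  by rewrite msupp0.
by move/msuppD_le; rewrite mem_cat => /orP [/dp|/dq].
Qed.

Lemma degree_leM d e p q : degree_le d p -> degree_le e q -> degree_le (d + e) (p * q).
Proof.
move=> dp dq m /msuppM_le /allpairsP [[m1 m2] [/dp m1d /dq m2d ->]] /=.
by rewrite mdegD leq_add.
Qed.

Lemma degree_leC (x : k) : degree_le 0 x%:MP.
Proof.
by move=> m; rewrite msuppC; case: eqP => //= _; rewrite inE => /eqP ->; rewrite mdeg0.
Qed.

Lemma degree_leX e p i : degree_le e p -> degree_le (i * e) (p ^+ i).
Proof.
move=> dp; elim: i => [|i IHi]; first by rewrite expr0; apply: degree_leC.
by rewrite exprS mulSn; apply: degree_leM.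
Qed.

Lemma degree_leW d e p : (d <= e)%N -> degree_le d p -> degree_le e p.
Proof. by move=> de dp m /dp /leq_trans; apply. Qed.

Lemma degree_power_comb e s c : (forall a, a \in s -> degree_le e a) ->
  degree_le (size s * (b * e)) (power_comb s c).
Proof.
elim: s c => [|a s IHs] c ds /=; first exact: degree_leC.
apply: degree_le_sum => i _; rewrite mulSn; apply: degree_leM.
  apply: (@degree_leW (i * e)); first by rewrite leq_mul2r ltnW ?orbT.
  by apply/degree_leX/ds; rewrite inE eqxx.
by apply: IHs => x xs; apply: ds; rewrite inE xs orbT.
Qed.

Lemma degree_bound (s : seq S) : exists e, forall a, a \in s -> degree_le e a.
Proof.
exists (\max_(a <- s) msize a) => a /(leq_bigmax_seq (F := fun a : S => msize a)) ae m.
by move/msize_mdeg_lt/ltnW/leq_trans; apply; apply: ae.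
Qed.

(** If the blocks with exponent of a below i have vanished, the power a ^+ i can be cancelled modulo
    J. Modulo J', which contains a, only block i is left, and the rest of the flag kills its
    coefficients. *)
Lemma power_comb_free J s c : ideal J -> regular_flag J s -> J (power_comb s c) ->
  forall l, size l = size s -> all (gtn b) l -> c l = 0.
Proof.
elim: s J c => [|a s IHs] J c iJ /=.
  move=> J1 Jc [] // _ _; apply: contra_notP J1 => /eqP c0.
  have -> : 1 = (c [::])^-1%:MP * (c [::])%:MP :> S by rewrite -mpolyCM mulVf.
  exact: idealM.
move=> [ra [J' [iJ' JJ' J'a rs]]] Jc.
suff low i : (i < b)%N -> forall l, size l = size s -> all (gtn b) l -> c (i :: l) = 0.
  by move=> [|i l] //= [sl] /andP [ib bl]; apply: low.
elim/ltn_ind: i => i IHi ib; apply: (IHs J') => //.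
set f := fun j : nat => a ^+ j * power_comb s (fun l => c (j :: l)).
have f0 j : (j < i)%N -> f j = 0.
  by move=> ji; rewrite /f power_comb0 ?mulr0 //; apply: IHi => //; apply: ltn_trans ib.
move: Jc; rewrite -(big_mkord xpredT f) (@big_cat_nat _ _ _ i) ?(ltnW ib) //=.
rewrite big_nat_cond big1 ?add0r => [|j /andP [/andP [_ ji] _]]; last exact: f0.
rewrite big_ltn // => Jc.
have {Jc} : J (power_comb s (fun l => c (i :: l)) +
    a * \sum_(i.+1 <= j < b) a ^+ (j - i.+1) * power_comb s (fun l => c (j :: l))).
  have ri x : J (a ^+ i * x) -> J x.
    elim: (i) x => [|j IHj] x; first by rewrite expr0 mul1r.
    by rewrite exprSr -mulrA => /IHj /ra.
  apply: ri; rewrite mulrDr mulrA -exprSr mulr_sumr.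
  move: Jc; congr (J (_ + _)); apply: eq_big_nat => j /andP [ij _].
  by rewrite mulrA -exprD subnKC.
move=> /JJ' Jc; rewrite -[power_comb _ _](addrK (a * \sum_(i.+1 <= j < b)
  a ^+ (j - i.+1) * power_comb s (fun l => c (j :: l)))).
by apply: idealB => //; apply: idealMl.
Qed.

End Counting.

Section FaceMonomials.
Local Open Scope ring_scope.
Variables (k : fieldType) (V : finType).
Local Notation S := {mpoly k[#|V|]}.
Implicit Types (D : {set {set V}}) (F : {set V}) (m : 'X_{1..#|V|}).

Definition mnm_support m : {set V} := [set v | m (enum_rank v) != 0%N].

(** For a complex D this is the Stanley-Reisner ideal, and for D = [powerset F] the prime ideal
    generated by the variables outside F. *)
Definition vanishing D (p : S) : Prop := forall m, mnm_support m \in D -> p@_m = 0.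

Lemma card_monomials D d N : (forall F, F \in D -> (#|F| <= d)%N) ->
  (#|[set g : {ffun V -> 'I_N.+1} | [set v | g v != ord0] \in D]| <= #|D| * N.+1 ^ d)%N.
Proof.
move=> Dd; rewrite -sum1_card.
rewrite (partition_big (fun g : {ffun V -> 'I_N.+1} => [set v | g v != ord0]) (mem D)) /=;
  last by move=> g; rewrite inE.
rewrite -sum_nat_const; apply: leq_sum => F FD; rewrite sum1dep_card.
apply: (@leq_trans (N.+1 ^ #|F|)); last by rewrite leq_pexp2l // Dd.
rewrite -[X in (X ^ _)%N]card_ord -(card_pffun_on ord0 (mem F) (mem predT)).
apply: subset_leq_card; apply/subsetP => g; rewrite inE => /andP [_ /eqP gF].
by apply/pffun_onP; split=> //; apply/subsetP => v vg; rewrite -gF inE.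
Qed.

(* The monomials in s with exponents below b are independent modulo J; for large
   b they outnumber the monomials of their degree supported on faces. *)
Lemma regular_flag_size (J : S -> Prop) (s : seq S) D d : ideal J ->
    (forall F, F \in D -> (#|F| <= d)%N) -> (forall p, vanishing D p -> J p) ->
  regular_flag J s -> (size s <= d)%N.
Proof.
move=> iJ Dd DJ rs; rewrite leqNgt; apply/negP => ds.
have [e se] := degree_bound s; set n := size s in ds.
(* N bounds the degree of the combinations, and N + 1 <= b * (n * e + 1). Hence #|D| * (N + 1) ^ d
   <= b ^ d * (b - 1) < b ^ d.+1 <= b ^ n. *)
pose b := (#|D| * (n * e).+1 ^ d).+1; pose N := (n * (b * e))%N.
pose T : finType := n.-tuple 'I_b.
pose M := [set g : {ffun V -> 'I_N.+1} | [set v | g v != ord0] \in D].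
pose mon (g : {ffun V -> 'I_N.+1}) := [multinom (g (enum_val i) : nat) | i < #|V|].
have MT : (#|M| < #|T|)%N.
  apply: leq_ltn_trans (card_monomials N Dd) _.
  rewrite card_tuple card_ord; apply: (@leq_trans (b ^ d.+1)); last first.
    by rewrite leq_pexp2l.
  rewrite expnSr; apply: (@leq_ltn_trans (b ^ d * (#|D| * (n * e).+1 ^ d))).
    rewrite mulnCA leq_mul2l -expnMn; apply/orP; right.
    by case: (d) => // d'; rewrite leq_exp2r // /N; nia.
  by rewrite ltn_mul2l expn_gt0 /= ltnSn.
pose delta (t : T) (l : seq nat) : k := (l == map val t)%:R.
(* One row for each tuple of exponents, one column for each monomial supported on a face with
   exponents at most N. There are more rows than columns, so a nonzero combination u of the rows
   vanishes and yields an element of J. *)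
pose A : 'M[k]_(#|T|, #|M|) :=
  \matrix_(i, j) (power_comb b s (delta (enum_val i)))@_(mon (enum_val j)).
have : kermx A != 0.
  rewrite kermx_eq0 /row_free neq_ltn; apply/orP; left.
  exact: leq_ltn_trans (rank_leq_col A) MT.
case/rowV0Pn => u /sub_kermxP uA u0.
pose c l := \sum_(t : T) u 0 (enum_rank t) * delta t l.
have cJ : J (power_comb b s c).
  apply: DJ => m mD; have [mN|Nm] := leqP (mdeg m) N; last first.
    apply/eqP; rewrite mcoeff_eq0; apply/negP => /(degree_power_comb se).
    by rewrite leqNgt Nm.
  have mi i : (m i < N.+1)%N.
    by apply: leq_trans mN; rewrite mdegE (bigD1 i) //= leq_addr.
  pose g := [ffun v => Ordinal (mi (enum_rank v))].
  have gM : g \in M.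
    rewrite inE (_ : [set v | _] = mnm_support m) //.
    by apply/setP=> v; rewrite !inE ffunE -val_eqE.
  have mg : mon g = m by apply/mnmP => i; rewrite mnmE ffunE /= enum_valK.
  have := congr1 (fun B : 'rV_#|M| => B 0 (enum_rank_in gM g)) uA.
  rewrite !mxE => uA0.
  rewrite /c power_comb_sum raddf_sum -[RHS]uA0.
  rewrite [LHS](reindex (fun i : 'I_#|T| => enum_val i)) /=; last first.
    by exists enum_rank => t _; rewrite ?enum_valK ?enum_rankK.
  apply: eq_bigr => i _; rewrite mcoeffZ mxE enum_valK enum_rankK_in //.
  by rewrite mg.
case/negP: u0; apply/eqP/rowP => i; rewrite mxE.
have cl := power_comb_free iJ rs cJ.
have := cl (map val (enum_val i)); rewrite size_map size_tuple => /(_ erefl).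
rewrite /c (bigD1 (enum_val i)) //= big1 => [|t ti]; last first.
  rewrite /delta (inj_eq (inj_map val_inj)) val_eqE eq_sym (negbTE ti) mulr0 //.
rewrite /delta eqxx mulr1 addr0 enum_valK => -> //.
by apply/allP => x /mapP [y _ ->] /=.
Qed.

End FaceMonomials.

Section RegularSequences.
Local Open Scope ring_scope.
Variable A : comNzRingType.
Implicit Types (J : A -> Prop) (s : seq A).

Lemma ideal_zero : ideal (fun x : A => x = 0).
Proof.
by split=> // [x y -> ->|a x ->]; rewrite ?addr0 ?mulr0.
Qed.

Lemma idealr_closed_ideal (P : {pred A}) : idealr_closed P -> ideal (fun x => x \in P).
Proof.
case=> P0 _ PD; split=> // [x y xP yP|a x xP]; first by rewrite -[x]mul1r; apply: PD.
by rewrite -[a * x]addr0; apply: PD.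
Qed.

Lemma ideal_idealr_closed J : ideal J -> ~ J 1 ->
  idealr_closed ([pred x | `[< J x >]] : {pred A}).
Proof.
move=> iJ J1; split; first by apply/asboolP; apply: ideal0.
  by apply/asboolPn.
move=> a x y /asboolP Jx /asboolP Jy; apply/asboolP.
by apply: idealD => //; apply: idealM.
Qed.

Lemma foldl_extendE J s x :
  foldl (@extend A) J s x <-> exists c : 'I_(size s) -> A, J (x - \sum_i c i * s`_i).
Proof.
elim: s J => [|a s IHs] J /=.
  split=> [Jx|[c]]; last by rewrite big_ord0 subr0.
  by exists (fun=> 0); rewrite big_ord0 subr0.
rewrite IHs; split=> [[c [d Jx]]|[c Jx]].
  exists (fun i => if unlift ord0 i is Some j then c j else d).
  rewrite big_ord_recl unlift_none /=; under eq_bigr => i _ do rewrite liftK.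
  by rewrite opprD addrA addrAC.
exists (fun i => c (lift ord0 i)), (c ord0).
by move: Jx; rewrite big_ord_recl /= opprD addrA addrAC.
Qed.

Lemma in_idealE s x : in_ideal s x <-> foldl (@extend A) (fun y => y = 0) s x.
Proof.
rewrite foldl_extendE; split=> -[c xc]; exists c; first by rewrite xc subrr.
by apply/eqP; rewrite -subr_eq0; apply/eqP.
Qed.

Lemma weakly_regularP J s : weakly_regular J s <->
  forall i, (i < size s)%N -> nonzerodiv (foldl (@extend A) J (take i s)) s`_i.
Proof.
elim: s J => [|a s IHs] J //=; rewrite IHs; split=> [[ra rs] [|i] //= si|rs].
  exact: rs.
by split=> [|i si]; [apply: (rs 0%N) | apply: (rs i.+1)].
Qed.

Lemma weakly_regular_rcons J s a : weakly_regular J (rcons s a) ->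
  weakly_regular J s /\ nonzerodiv (foldl (@extend A) J s) a.
Proof.
elim: s J => [|b s IHs] J /=; first by case.
by case=> rb /IHs [rs ra].
Qed.

Lemma regular_sequenceE s : regular_sequence s <->
  weakly_regular (fun y => y = 0) s /\ ~ foldl (@extend A) (fun y => y = 0) s 1.
Proof.
rewrite /regular_sequence weakly_regularP in_idealE.
split=> -[rs s1]; split=> // i; first by move=> si x; rewrite -!in_idealE; apply: rs.
by move=> x si; rewrite !in_idealE; apply: rs.
Qed.

(* By Zorn's lemma, an ideal maximal among those avoiding T is prime. *)
Lemma prime_avoiding J (T : A -> Prop) : ideal J -> T 1 ->
    (forall x y, T x -> T y -> T (x * y)) -> (forall x, T x -> ~ J x) ->
  exists Q : {pred A}, [/\ prime_ideal Q, forall x, J x -> x \in Q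
    & forall x, T x -> x \notin Q].
Proof.
move=> iJ T1 TM TJ.
pose good (I : A -> Prop) :=
  [/\ ideal I, forall x, J x -> I x & forall x, T x -> ~ I x].
pose R (I I' : {I | good I}) := `[< forall x, sval I x -> sval I' x >].
have [|||C totC|[Q [iQ JQ TQ]] maxQ] := classical_sets.Zorn (R := R).
- by move=> I; apply/asboolP.
- move=> I1 I2 I3 /asboolP I12 /asboolP I23; apply/asboolP => x /I12 /I23 //.
- move=> [I1 g1] [I2 g2] /asboolP /= I12 /asboolP /= I21.
  have e : I1 = I2 by apply/funext => x; apply/propext; split; [apply: I12|apply: I21].
  by case: _ / e g2 I12 I21 => g2 _ _; congr exist; apply: Prop_irrelevance.
(* The union of the chain; J is included so that the empty chain has an upper bound as well. *)
- pose U x := J x \/ exists2 I, C I & sval I x.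
  have gU : good U.
    split.
    + split; first by left; apply: ideal0.
        move=> x y [Jx|[I1 C1 I1x]] [Jy|[I2 C2 I2y]].
        * by left; apply: idealD.
        * by right; exists I2 => //; have [? JI _] := svalP I2; apply: idealD; auto.
        * by right; exists I1 => //; have [? JI _] := svalP I1; apply: idealD; auto.
        * right; have [/asboolP I12|/asboolP I21] := totC _ _ C1 C2.
            by exists I2 => //; have [? _ _] := svalP I2; apply: idealD; auto.
          by exists I1 => //; have [? _ _] := svalP I1; apply: idealD; auto.
      move=> a x [Jx|[I1 C1 I1x]]; first by left; apply: idealM.
      by right; exists I1 => //; have [? _ _] := svalP I1; apply: idealM.
    + by left.
    + move=> x Tx [/(TJ _ Tx) //|[I1 C1 I1x]].
      by have [_ _ /(_ _ Tx)] := svalP I1.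
  exists (exist _ U gU) => I CI; apply/asboolP => x Ix; right; by exists I.
(* By maximality, adding x to Q produces an element of T. For u and v outside Q with product in Q,
   multiplying the two elements so obtained would put an element of T into Q. *)
have grow x : ~ Q x -> exists t c, T t /\ Q (t - c * x).
  move=> Qx; apply: contrapT => nt.
  have gx : good (extend Q x).
    split; first exact: ideal_extend.
      by move=> y /JQ; apply: extend_sub.
    by move=> t Tt [c Qc]; apply: nt; exists t, c.
  have /(congr1 sval) /= e : exist _ _ gx = exist _ Q (And3 iQ JQ TQ).
    by apply: maxQ; apply/asboolP => y /=; apply: extend_sub.
  by apply: Qx; have := extend_gen x iQ; rewrite e.
exists ([pred x | `[< Q x >]] : {pred A}); split=> [|x /JQ Qx|x /TQ Qx]; last 2 first.
- exact/asboolP.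
- exact/asboolPn.
have Q1 := TQ _ T1; clear maxQ.
split; first exact: ideal_idealr_closed.
move=> u v /asboolP Quv; rewrite !inE; apply: contrapT => /negP; rewrite negb_or.
move=> /andP [/asboolPn /grow [t [c [Tt Qt]]] /asboolPn /grow [t' [c' [Tt' Qt']]]].
apply: TQ (TM _ _ Tt Tt') _.
have -> : t * t' = t * (t' - c' * v) + (c' * v) * (t - c * u) + (c' * c) * (u * v) by ring.
by repeat (apply: idealD => //); apply: idealM.
Qed.

(* The products u * a ^+ n with u outside P avoid J. *)
Lemma prime_below J (P : {pred A}) a : ideal J -> (forall x, J x -> x \in P) ->
    prime_ideal P -> nonzerodiv J a ->
  exists Q : {pred A}, [/\ prime_ideal Q, forall x, J x -> x \in Q,
    {subset Q <= P} & a \notin Q].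
Proof.
move=> iJ JP [[P0 P1 PD] pP] ra.
pose T x := exists u n, u \notin P /\ x = u * a ^+ n.
have [||x y [u [n [uP ->]]] [t [m [tP ->]]]||Q [pQ JQ TQ]] := @prime_avoiding J T.
- by [].
- by exists 1, 0%N; rewrite mulr1.
- exists (u * t), (n + m)%N; rewrite exprD mulrACA; split=> //.
  by apply/negP => /pP; rewrite (negbTE uP) (negbTE tP).
- move=> x [u [n [uP ->]]] Ju; case/negP: uP; apply: JP.
  by elim: n Ju => [|n IHn]; rewrite ?mulr1 // exprS mulrCA => /ra.
exists Q; split=> // [x|]; last by apply: TQ; exists 1, 1%N; rewrite mul1r.
by apply: contraLR => xP; apply: TQ; exists x, 0%N; rewrite mulr1.
Qed.

(** The chain is built from the top: the last element a of s is a nonzerodivisor modulo the others,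
    so some prime inside P contains J and the others but not a, and the induction continues below
    it. *)
Lemma regular_prime_chain J s (P : {pred A}) : ideal J -> (forall x, J x -> x \in P) ->
  weakly_regular J s -> {subset s <= P} -> prime_ideal P -> prime_chain P (size s).
Proof.
move=> iJ; elim/last_ind: s P => [|s a IHs] P JP.
  by move=> _ _ pP; exists (fun=> P); split.
move=> /weakly_regular_rcons [rs ra] sP pP; rewrite size_rcons.
have iP : ideal (fun x => x \in P) by apply: idealr_closed_ideal; case: pP.
have JsP x : foldl (@extend A) J s x -> x \in P.
  apply: (foldl_extend_min (J' := fun x => x \in P)) => // y ys.
  by apply: sP; rewrite mem_rcons inE ys orbT.
have [Q [pQ JQ QP aQ]] := prime_below (ideal_foldl_extend s iJ) JsP pP ra.
have [||||C [pC incC CQ]] := IHs Q => //.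
- by move=> x Jx; apply: JQ; apply: foldl_extend_sub.
- by move=> x xs; apply: JQ; apply: foldl_extend_mem.
exists (fun i => if (i <= size s)%N then C i else P); split=> [i _|i|]; last first.
- by rewrite ltnn.
- rewrite ltnS => is_; rewrite is_; case: ltngtP is_ => // [/incC //|->] _.
  split=> [x|PC]; first by rewrite CQ; apply: QP.
  by case/negP: aQ; rewrite -CQ; apply/PC/sP; rewrite mem_rcons inE eqxx.
by case: leqP => // /pC.
Qed.

(** An element of a prime of the chain outside the preceding prime is a nonzerodivisor modulo the
    latter. *)
Lemma prime_chain_flag (P : {pred A}) n : prime_chain P n ->
  exists s (Q : {pred A}), [/\ prime_ideal Q, size s = n & regular_flag (fun x => x \in Q) s].
Proof.
case=> C [pC incC _].
suff H i : (i <= n)%N -> exists2 s, size s = (n - i)%N & regular_flag (fun x => x \in C i) s.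
  by have [s ss fs] := H 0%N isT; exists s, (C 0%N); rewrite ss subn0; split=> //; apply: pC.
move=> /subKn <-; elim: (n - i)%N (leq_subr i n) => [|j IHj] jn.
  exists [::]; rewrite ?subn0 ?subnn //= => C1.
  by have [[_ /negP []]] := pC n (leqnn _).
have [s ss fs] := IHj (ltnW jn).
have [|sub /existsNP [a /not_implyP [aC aN]]] := incC (n - j.+1)%N.
  by rewrite ltn_subrL (leq_trans _ jn).
rewrite subnSK // in aC sub.
exists (a :: s); first by rewrite /= ss; lia.
split=> [x|].
  have [_ pCj] := pC _ (leq_subr j.+1 n).
  by move=> /pCj /orP [/aN|].
exists (fun x => x \in C (n - j)%N); split=> //.
by apply: idealr_closed_ideal; case: (pC _ (leq_subr j n)).
Qed.

End RegularSequences.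

Section Transfer.
Local Open Scope ring_scope.
Variables (A B : comNzRingType) (f : {rmorphism A -> B}).
Hypothesis f_surj : forall y, exists x, f x = y.
Implicit Types (J : B -> Prop) (s : seq A).

Lemma extend_preim J a : extend J (f a) \o f = extend (J \o f) a.
Proof.
apply/funext => x; apply/propext; split=> [[c] |[c]] /=.
  by have [d <-] := f_surj c; rewrite -rmorphM -rmorphB => Jd; exists d.
by rewrite rmorphB rmorphM => Jd; exists (f c).
Qed.

Lemma weakly_regular_preim J s :
  weakly_regular J (map f s) <-> weakly_regular (J \o f) s.
Proof.
elim: s J => //= a s IHs J; rewrite IHs extend_preim; split=> -[ra rs]; split=> // x.
  by rewrite /= rmorphM; apply: ra.
by have [y <-] := f_surj x; rewrite -rmorphM; apply: ra.
Qed.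

Lemma ideal_preim J : ideal J -> ideal (J \o f).
Proof.
case=> J0 JD JM; split=> [|x y|a x] /=; first by rewrite rmorph0.
  by rewrite rmorphD; apply: JD.
by rewrite rmorphM; apply: JM.
Qed.

Lemma regular_flag_preim J s : regular_flag J (map f s) -> regular_flag (J \o f) s.
Proof.
elim: s J => [|a s IHs] J /=; first by rewrite rmorph1.
case=> ra [J' [iJ' JJ' J'a rs]]; split=> [x /=|]; first by rewrite rmorphM; apply: ra.
exists (J' \o f); split=> //=; first exact: ideal_preim.
  by move=> x; apply: JJ'.
exact: IHs.
Qed.

Lemma map_surj (s : seq B) : exists t, map f t = s.
Proof.
elim: s => [|b s [t <-]]; first by exists [::].
by have [a <-] := f_surj b; exists (a :: t).
Qed.

End Transfer.

(** * Stanley-Reisner rings *)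

Section VanishingIdeals.
Local Open Scope ring_scope.
Variables (k : fieldType) (V : finType).
Local Notation S := {mpoly k[#|V|]}.
Implicit Types (D : {set {set V}}) (E F : {set V}) (m : 'X_{1..#|V|}) (p : S).

Definition mnm_set E : 'X_{1..#|V|} := [multinom (enum_val i \in E : nat) | i < #|V|].

Lemma mnm_setE E v : mnm_set E (enum_rank v) = (v \in E).
Proof. by rewrite mnmE enum_rankK. Qed.

Lemma mnm_support_set E : mnm_support (mnm_set E) = E.
Proof. by apply/setP => v; rewrite inE mnm_setE; case: (v \in E). Qed.

Lemma mnm_supportD m1 m2 : mnm_support (m1 + m2)%MM = mnm_support m1 :|: mnm_support m2.
Proof. by apply/setP => v; rewrite !inE mnmDE addn_eq0 negb_and. Qed.

Lemma mnm_set_le E m : (mnm_set E <= m)%MM = (E \subset mnm_support m).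
Proof.
apply/mnm_lepP/subsetP => [Em v vE|Em i].
  by have := Em (enum_rank v); rewrite mnm_setE vE inE lt0n.
rewrite mnmE; case: (boolP (enum_val i \in E)) => // /Em.
by rewrite inE enum_valK lt0n.
Qed.

Lemma face_monomialE E : face_monomial k E = 'X_[mnm_set E].
Proof.
rewrite /face_monomial mprodXE; congr ('X_[_]); apply/mnmP => i.
rewrite mnm_sumE mnmE -[i]enum_valK.
under eq_bigr => v _ do rewrite mnm1E (inj_eq enum_rank_inj).
rewrite enum_rankK; case: (boolP (enum_val i \in E)) => iE.
  by rewrite (bigD1 (enum_val i)) //= eqxx big1 // => v /andP [_ /negbTE ->].
by rewrite big1 // => v vE; case: eqP => // e; rewrite -e vE in iE.
Qed.

Lemma mcoeffMX_le p a m : (p * 'X_[a])@_m = if (a <= m)%MM then p@_(m - a)%MM else 0.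
Proof.
case: (boolP (a <= m)%MM) => am; first by rewrite -[m in LHS](submK am) [in LHS]addmC mcoeffMX.
apply/eqP; rewrite mcoeff_eq0; apply: contra am => /msuppM_le /allpairsP [[m1 m2] /= [_ + ->]].
by rewrite msuppX inE => /eqP ->; apply: lem_addl.
Qed.

Lemma ideal_vanishing D : down_closed D -> ideal (@vanishing k V D).
Proof.
move=> cD; split=> [m _|p q Dp Dq m mD|a p Dp m mD]; first by rewrite mcoeff0.
  by rewrite mcoeffD Dp // Dq // addr0.
apply/eqP; rewrite mcoeff_eq0; apply/negP => /msuppM_le /allpairsP [[m1 m2] /= [_ + e]].
rewrite mcoeff_msupp Dp ?eqxx //= ; apply: cD mD.
by rewrite e mnm_supportD subsetUr.
Qed.

Lemma vanishing_monomial D m : mnm_support m \notin D -> vanishing D ('X_[m] : S).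
Proof. by move=> mD m' m'D; rewrite mcoeffX; case: eqP => // e; rewrite e m'D in mD. Qed.

Lemma vanishing_ind D (J : S -> Prop) p : ideal J ->
    (forall m, mnm_support m \notin D -> J 'X_[m]) ->
  vanishing D p -> J p.
Proof.
move=> iJ Jm Dp; rewrite [p]mpolyE big_seq_cond; apply: (ideal_sum _ iJ) => m /andP [mp _].
rewrite -mul_mpolyC; apply: idealM => //; apply: Jm; apply/negP => mD.
by move: mp; rewrite mcoeff_msupp Dp ?eqxx.
Qed.

Variable D : complex V.

Lemma sr_idealE p : (p \in sr_ideal k D) <-> vanishing D p.
Proof.
split=> [/asboolP [c ->]|Dp].
  have iD : ideal (@vanishing k V D) by apply: ideal_vanishing; apply: complex_sub.
  apply: (ideal_sum _ iD) => i _; apply: (idealM _ iD).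
  have /mapP [s] := mem_nth 0 (ltn_ord i).
  rewrite mem_enum inE => sD /= ->; rewrite face_monomialE.
  by apply: vanishing_monomial; rewrite mnm_support_set.
have iS := idealr_closed_ideal (sr_ideal_closed k D).
apply: (vanishing_ind iS) Dp => m mD.
rewrite -(submK (m := mnm_set (mnm_support m)) (m' := m)) ?mnm_set_le // mpolyXD.
apply: (idealM _ iS); apply/asboolP/in_idealE; rewrite -face_monomialE.
apply: foldl_extend_mem; first exact: ideal_zero.
by apply: map_f; rewrite mem_enum inE.
Qed.

End VanishingIdeals.

Section StanleyReisnerProjection.
Local Open Scope ring_scope.
Local Open Scope quotient_scope.
Variables (k : fieldType) (V : finType) (D : complex V).
Local Notation S := {mpoly k[#|V|]}.

Definition sr_proj : S -> sr_ring k D := \pi_{ideal_quot (sr_ideal k D)}.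

Lemma sr_proj_additive : zmod_morphism sr_proj.
Proof. exact: (@raddfB _ _ \pi_{ideal_quot (sr_ideal k D)}). Qed.

Lemma sr_proj_multiplicative : monoid_morphism sr_proj.
Proof.
split; first exact: (rmorph1 \pi_{ideal_quot (sr_ideal k D)}).
exact: (rmorphM \pi_{ideal_quot (sr_ideal k D)}).
Qed.

HB.instance Definition _ := GRing.isZmodMorphism.Build S (sr_ring k D) sr_proj
  sr_proj_additive.
HB.instance Definition _ := GRing.isMonoidMorphism.Build S (sr_ring k D) sr_proj
  sr_proj_multiplicative.

Lemma sr_proj_surj y : exists x, sr_proj x = y.
Proof. by exists (repr y); rewrite /sr_proj reprK. Qed.

Lemma sr_proj_eq0 p : sr_proj p = 0 <-> vanishing D p.
Proof.
rewrite -sr_idealE -{2}[p]subr0 Quotient.idealrBE -(rmorph0 sr_proj).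
by split=> [e|/eqP //]; apply/eqP.
Qed.

Lemma sr_flag_size (J : sr_ring k D -> Prop) s : ideal J -> regular_flag J s ->
  (size s <= dimS D)%N.
Proof.
move=> iJ; have [t <-] := map_surj sr_proj_surj s.
move=> /regular_flag_preim rt; rewrite size_map.
apply: (regular_flag_size (ideal_preim _ iJ) _ _ rt (D := D)); first exact: dimS_ge.
by move=> p /sr_proj_eq0 /= ->; apply: ideal0.
Qed.

Lemma sr_regular_size (s : seq (sr_ring k D)) : regular_sequence s -> (size s <= dimS D)%N.
Proof.
move=> /regular_sequenceE [rs s1]; apply: (@sr_flag_size (fun y => y = 0)).
  exact: ideal_zero.
by apply: weakly_regular_flag => //; apply: ideal_zero.
Qed.

Lemma sr_chain_size (P : {pred sr_ring k D}) n : prime_chain P n -> (n <= dimS D)%N.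
Proof.
case/prime_chain_flag => s [Q [[iQ _] <- fs]].
exact: sr_flag_size (idealr_closed_ideal iQ) fs.
Qed.

End StanleyReisnerProjection.

(** * Residue fields of maximal ideals *)

Section MaximalIdeals.
Local Open Scope ring_scope.
Local Open Scope quotient_scope.
Variables (A : comNzRingType) (P : {pred A}).
Hypothesis maxP : maximal_ideal P.

Lemma maximal_ideal_inv u : u \notin P -> exists c, c * u - 1 \in P.
Proof.
move=> uP; have [iP max] := maxP; have idP := idealr_closed_ideal iP.
have iPu := ideal_extend u idP.
have [[c Pc]|nPu] := pselect (extend (fun x => x \in P) u 1).
  by exists c; rewrite -opprB; apply: (idealN idP).
case/negP: uP; apply: (max _ (ideal_idealr_closed iPu nPu)).
  by move=> x xP; apply/asboolP; apply: extend_sub.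
by apply/asboolP; apply: extend_gen.
Qed.

Lemma maximal_ideal_prime : prime_ideal P.
Proof.
have [iP _] := maxP; split=> // u v uvP; have idP := idealr_closed_ideal iP.
case: (boolP (u \in P)) => //= /maximal_ideal_inv [c cu].
have -> : v = c * (u * v) - (c * u - 1) * v by ring.
by apply: (idealB idP); [apply: (idealM _ idP) | apply: (idealMl _ idP)].
Qed.

(* The unused argument lets the Idealr instance depend on maxP. *)
Definition residue_ideal of maximal_ideal P : {pred A} := P.
HB.instance Definition _ := isIdealr.Build A (residue_ideal maxP) (proj1 maxP).

Definition residue_ring : comNzRingType := {ideal_quot (residue_ideal maxP)}.
Definition residue_proj : A -> residue_ring := \pi_{ideal_quot (residue_ideal maxP)}.

Lemma residue_proj_additive : zmod_morphism residue_proj.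
Proof. exact: (@raddfB _ _ \pi_{ideal_quot (residue_ideal maxP)}). Qed.

Lemma residue_proj_multiplicative : monoid_morphism residue_proj.
Proof.
split; first exact: (rmorph1 \pi_{ideal_quot (residue_ideal maxP)}).
exact: (rmorphM \pi_{ideal_quot (residue_ideal maxP)}).
Qed.

HB.instance Definition _ := GRing.isZmodMorphism.Build A residue_ring residue_proj
  residue_proj_additive.
HB.instance Definition _ := GRing.isMonoidMorphism.Build A residue_ring residue_proj
  residue_proj_multiplicative.

Lemma residue_proj_surj y : exists x, residue_proj x = y.
Proof. by exists (repr y); rewrite /residue_proj reprK. Qed.

Lemma residue_proj_eq0 x : (residue_proj x == 0) = (x \in P).
Proof.
have -> : (x \in P) = (x - 0 \in residue_ideal maxP) by rewrite subr0.
by rewrite Quotient.idealrBE -[0 in LHS](rmorph0 residue_proj).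
Qed.

Lemma residue_inv (y : residue_ring) : exists z, y != 0 -> z * y = 1.
Proof.
have [x <-] := residue_proj_surj y; case: (boolP (x \in P)) => [xP|/maximal_ideal_inv [c cx]].
  by exists 0; rewrite residue_proj_eq0 xP.
exists (residue_proj c) => _; apply/eqP; rewrite -rmorphM -subr_eq0.
by rewrite -(rmorph1 residue_proj) -rmorphB residue_proj_eq0.
Qed.

Definition residue_field : Type := residue_ring.
HB.instance Definition _ := GRing.ComNzRing.on residue_field.
Definition residue_invr (y : residue_field) : residue_field :=
  if y == 0 then 0 else projT1 (cid (residue_inv y)).

Lemma residue_mulVf y : y != 0 -> residue_invr y * y = 1.
Proof.
by move=> y0; rewrite /residue_invr ifN //; case: cid => z /=; apply.
Qed.

Lemma residue_invr0 : residue_invr 0 = 0.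
Proof. by rewrite /residue_invr ifT. Qed.

HB.instance Definition _ := GRing.ComNzRing_isField.Build residue_field
  residue_mulVf residue_invr0.

Definition residue_map : A -> residue_field := residue_proj.
HB.instance Definition _ := GRing.RMorphism.on residue_map.

End MaximalIdeals.

Section ResidueAlgebraic.
Local Open Scope ring_scope.
Variables (k : fieldType) (n : nat) (A : comNzRingType) (f : {rmorphism {mpoly k[n]} -> A}).
Hypothesis f_surj : forall y, exists x, f x = y.

(** The residue field is generated over k by the images of the variables, so by Zariski's lemma the
    image of x satisfies a monic equation over k. *)
Lemma maximal_ideal_algebraic (P : {pred A}) (x : {mpoly k[n]}) : maximal_ideal P ->
  exists2 p : {poly k}, p \is monic & f (map_poly (@mpolyC n k) p).[x] \in P.
Proof.
move=> maxP.
have [g ge] : exists g : {rmorphism {mpoly k[n]} -> residue_field maxP},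
    forall w, residue_proj maxP (f w) = g w by exists (residue_map maxP \o f).
pose iota : {rmorphism k -> residue_field maxP} := g \o @mpolyC n k.
have alg : algebraicOver iota (g x).
  apply: (zariski (s := [seq g 'X_i | i : 'I_n])) => Q Qsub Qmul Qk QX y.
  have [z <-] := residue_proj_surj y; have [w <-] := f_surj z; rewrite ge.
  have gM a b : g (a * b) = g a * g b by exact: rmorphM.
  have Q0 : Q 0 by have := Qk 0; rewrite rmorph0.
  have Q1 : Q 1 by have := Qk 1; rewrite rmorph1.
  have Qadd a b : Q a -> Q b -> Q (a + b).
    by move=> Qa Qb; rewrite -[b]opprK; apply: (Qsub _ _ Qa); rewrite -sub0r; apply: Qsub.
  rewrite [w]mpolyE raddf_sum /=; apply: (big_ind Q) => // m _.
  rewrite -mul_mpolyC gM; apply: (Qmul _ _ (Qk _)).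
  rewrite mpolyXE_id; apply: (big_ind (fun z => Q (g z))) => [|a b|i _].
    by rewrite rmorph1.
    by rewrite gM; apply: (Qmul _ _).
  elim: (m i) => [|j IHj]; first by rewrite expr0 rmorph1.
  by rewrite exprS gM; apply: (Qmul _ _) => //; apply: (QX _); apply: map_f; rewrite mem_enum.
have [p mp px] := (integral_algebraic iota (g x)).1 alg.
exists p => //; rewrite -(residue_proj_eq0 maxP).
rewrite ge -horner_map -map_poly_comp; exact: px.
Qed.

End ResidueAlgebraic.

(** * Shellable balanced complexes are Cohen-Macaulay *)

Section VariableSeparation.
Local Open Scope ring_scope.
Variables (k : fieldType) (V : finType).
Local Notation S := {mpoly k[#|V|]}.
Implicit Types (C F : {set V}) (y : V) (J : S -> Prop).

Definition linear_form C : S := \sum_(v in C) 'X_(enum_rank v).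

(* The substitution X_y := 'X - sum_(v in C :\ y) X_v presents S as polynomials
   in the linear form of C whose coefficients do not involve X_y. *)
Definition separate C y : S -> {poly S} :=
  mmap (@polyC S \o @mpolyC #|V| k) (fun i => if i == enum_rank y
    then 'X - (linear_form (C :\ y))%:P else ('X_i)%:P).
HB.instance Definition _ C y := GRing.RMorphism.on (separate C y).

(** [separate] maps J into J['X], so that modulo J the linear form of C behaves like a free
    variable. *)
Definition separated C y J := forall p, J p -> forall i, J (separate C y p)`_i.

Lemma separateC C y c : separate C y c%:MP = c%:MP%:P.
Proof. exact: mmapC. Qed.

Lemma separateX C y v : separate C y 'X_(enum_rank v) =
  if v == y then 'X - (linear_form (C :\ y))%:P else ('X_(enum_rank v))%:P.
Proof. by rewrite /separate mmapX mmap1U (inj_eq enum_rank_inj). Qed.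

Lemma separate_linear_form C y : y \in C -> separate C y (linear_form C) = 'X.
Proof.
move=> yC; rewrite {1}/linear_form (big_setD1 y) //= rmorphD rmorph_sum /=.
rewrite separateX eqxx (eq_bigr (fun v => ('X_(enum_rank v))%:P)).
  by rewrite -(rmorph_sum (@polyC S)) -/(linear_form _) subrK.
by move=> v; rewrite !inE => /andP [/negbTE vy _]; rewrite separateX vy.
Qed.

Lemma separate_other C C' y : y \notin C' ->
  separate C y (linear_form C') = (linear_form C')%:P.
Proof.
move=> yC'; rewrite /linear_form !rmorph_sum /=; apply: eq_bigr => v vC'.
by rewrite separateX; case: eqP => // e; rewrite -e vC' in yC'.
Qed.

Lemma separate_poly C y (p : {poly k}) q : separate C y (map_poly (@mpolyC _ k) p).[q] =
  (map_poly (@polyC S \o @mpolyC _ k) p).[separate C y q].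
Proof.
rewrite -horner_map -map_poly_comp; congr (_.[_]); apply: eq_map_poly => c.
exact: separateC.
Qed.

Lemma separateK C y p : y \in C -> (separate C y p).[linear_form C] = p.
Proof.
move=> yC; rewrite /separate /mmap horner_sum [RHS]mpolyE; apply: eq_bigr => m _ /=.
rewrite hornerM hornerC -mul_mpolyC mpolyXE_id; congr (_ * _).
rewrite /mmap1 horner_prod; apply: eq_bigr => i _; rewrite horner_exp; congr (_ ^+ _).
case: eqP => [->|_]; last by rewrite hornerC.
by rewrite hornerD hornerN hornerX hornerC {1}/linear_form (big_setD1 y) //= addrK.
Qed.

(** Downward induction on i, with n bounding [size g - i]: in coefficient i + m of q * g, m being
    the degree of q, the terms with j > i lie in J by induction and those with j < i are zero. *)
Lemma nonzerodiv_monic J (q g : {poly S}) : ideal J -> q \is monic ->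
  (forall i, J (q * g)`_i) -> forall i, J g`_i.
Proof.
move=> iJ mq Jqg.
suff H n i : (size g <= i + n)%N -> J g`_i by move=> i; apply: (H (size g)); rewrite leq_addl.
elim/ltn_ind: n i => n IHn i sg.
have [gi|ig] := leqP (size g) i; first by rewrite nth_default //; apply: ideal0.
set m := (size q).-1.
have := Jqg (i + m)%N; rewrite coefMr => Jc.
have im : (i < (i + m).+1)%N by rewrite ltnS leq_addr.
rewrite (bigD1 (Ordinal im)) //= addKn -[q`_m]/(lead_coef q) (monicP mq) mul1r in Jc.
rewrite -[g`_i](addrK (\sum_(j < (i + m).+1 | j != Ordinal im) q`_(i + m - j) * g`_j)).
apply: (idealB iJ) => //; apply: (ideal_sum _ iJ) => j ji.
have {ji} : nat_of_ord j != i by rewrite -val_eqE in ji.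
rewrite neq_ltn => /orP [ji|ij].
  rewrite [q`__]nth_default ?mul0r; first exact: ideal0.
  have : (0 < size q)%N by rewrite size_poly_gt0 monic_neq0.
  have aux a b c : (b < a -> 0 < c -> c <= a + c.-1 - b)%N by lia.
  exact: aux.
by apply: (idealM _ iJ); apply: (IHn (n - (j - i))%N); lia.
Qed.

(** [separate] turns the value of p at the linear form into the monic polynomial p in 'X. *)
Lemma separated_nonzerodiv C y J (p : {poly k}) : ideal J -> separated C y J ->
  y \in C -> p \is monic -> nonzerodiv J (map_poly (@mpolyC _ k) p).[linear_form C].
Proof.
move=> iJ sJ yC mp x /sJ Jpx; rewrite -(separateK x yC) horner_coef.
apply: (ideal_sum _ iJ) => i _; apply: (idealMl _ iJ).
suff : forall i, J (separate C y x)`_i by apply.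
apply: (nonzerodiv_monic iJ (q := map_poly (@mpolyC _ k) p)); first exact: monic_map.
move=> j; have := Jpx j; rewrite rmorphM /= separate_poly separate_linear_form //.
by rewrite map_poly_comp -/(comp_poly 'X _) comp_polyXr.
Qed.

Lemma separated_extend C C' y J (p : {poly k}) : ideal J -> separated C y J ->
  y \notin C' -> separated C y (extend J (map_poly (@mpolyC _ k) p).[linear_form C']).
Proof.
move=> iJ sJ yC' x [c /sJ Jc] i; have := Jc i.
rewrite rmorphB rmorphM /= separate_poly separate_other // map_poly_comp horner_map /=.
by rewrite coefB coefMC; exists (separate C y c)`_i.
Qed.

(** The ideal is generated by the variables outside F, and the substitution fixes these because y is
    in F. *)
Lemma separated_facet C y F : y \in F -> separated C y (vanishing (powerset F)).
Proof.
move=> yF; set K := vanishing _.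
have iK : ideal K.
  by apply: ideal_vanishing => A B AB; rewrite !inE; apply: subset_trans.
suff sK : forall p, K p -> [pred q : {poly S} | `[< forall i, K q`_i >]] (separate C y p).
  by move=> p /sK /asboolP.
have iKX : ideal (fun q : {poly S} => [pred q : {poly S} | `[< forall i, K q`_i >]] q).
  split=> [|a b /asboolP Ka /asboolP Kb|a b /asboolP Kb]; apply/asboolP => i.
  - by rewrite coef0; apply: (ideal0 iK).
  - by rewrite coefD; apply: (idealD iK).
  - by rewrite coefM; apply: (ideal_sum _ iK) => j _; apply: (idealM _ iK).
move=> p; apply: (vanishing_ind (ideal_preim (separate C y) iKX)) => m /=.
rewrite inE => /subsetPn [v vm vF].
have vm' : (mnm_set [set v] <= m)%MM by rewrite mnm_set_le sub1set.
rewrite -(submK vm') mpolyXD rmorphM /=; apply: (idealM _ iKX).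
have -> : mnm_set [set v] = U_(enum_rank v)%MM.
  by apply/mnmP => i; rewrite mnmE mnm1E inE -(inj_eq enum_rank_inj) enum_valK eq_sym.
rewrite separateX; case: eqP => [e|_]; first by rewrite e yF in vF.
apply/asboolP => i; rewrite coefC; case: eqP => _; last exact: (ideal0 iK).
apply: vanishing_monomial; rewrite inE; apply: contra vF => /subsetP; apply.
by rewrite inE mnm1E eqxx.
Qed.

(** Class j is treated with the vertex y j. The other classes do not contain y j, so adding their
    elements to J keeps it separated for class j. *)
Lemma separated_regular (I : eqType) (C : I -> {set V}) (y : I -> V)
    (p : I -> {poly k}) J s : ideal J -> uniq s ->
    (forall j, y j \in C j) -> (forall i j, i != j -> y i \notin C j) ->
    (forall j, p j \is monic) -> (forall j, separated (C j) (y j) J) ->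
  weakly_regular J [seq (map_poly (@mpolyC _ k) (p j)).[linear_form (C j)] | j <- s].
Proof.
move=> iJ us yC yC' mp.
suff H : (forall j, j \in s -> separated (C j) (y j) J) ->
    weakly_regular J [seq (map_poly (@mpolyC _ k) (p j)).[linear_form (C j)] | j <- s].
  by move=> sJ; apply: H.
elim: s J iJ us => //= j s IHs J iJ /andP [js us] sJ; split.
  by apply: (separated_nonzerodiv iJ (sJ j _)); rewrite ?mem_head.
apply: IHs => // [|i is_]; first exact: ideal_extend.
apply: separated_extend => //; first by apply: sJ; rewrite inE is_ orbT.
by apply: yC'; apply: contraNneq js => <-.
Qed.

End VariableSeparation.

Section ShellingRegular.
Local Open Scope ring_scope.
Variables (k : fieldType) (V : finType).
Local Notation S := {mpoly k[#|V|]}.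
Implicit Types (F G : {set V}) (Fs : seq {set V}).

Definition generated Fs : {set {set V}} :=
  [set G : {set V} | has (fun F : {set V} => G \subset F) Fs].

Lemma generated_closed Fs : down_closed (generated Fs).
Proof.
move=> A B AB; rewrite !inE => /hasP [F FFs BF]; apply/hasP; exists F => //.
exact: subset_trans AB BF.
Qed.

Lemma generated_facets (D : complex V) Fs : Fs =i facets D -> generated Fs = D.
Proof.
move=> mFs; apply/setP => G; rewrite inE; apply/hasP/idP => [[F]|GD].
  by rewrite mFs => /facet_face FD GF; apply: complex_sub GF FD.
by have [F FD GF] := facet_above GD; exists F; rewrite ?mFs.
Qed.

Lemma weakly_regular_total (A : comNzRingType) (J : A -> Prop) s :
  (forall x, J x) -> weakly_regular J s.
Proof.
elim: s J => //= a s IHs J JT; split=> //; apply: IHs => x.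
by exists 0; apply: JT.
Qed.

(* R is the restriction of the shelling step adding F. *)
Lemma shelling_step Fs F (R : {set V}) s :
    R \subset F -> (forall G, G \in Fs -> ~~ (R \subset G)) ->
    (forall G, G \subset F -> G \notin generated Fs -> R \subset G) ->
    weakly_regular (@vanishing k V (powerset F)) s ->
  weakly_regular (@vanishing k V (generated Fs)) s ->
  weakly_regular (@vanishing k V (generated (rcons Fs F))) s.
Proof.
move=> RF RFs minR rF rFs.
set I := vanishing (generated (rcons Fs F)).
have iI : ideal I by apply/ideal_vanishing/generated_closed.
have iJ : ideal (@vanishing k V (powerset F)).
  by apply: ideal_vanishing => A B AB; rewrite !inE; apply: subset_trans.
have iFs : ideal (@vanishing k V (generated Fs)).
  exact/ideal_vanishing/generated_closed.
(* No earlier facet contains R, so a multiple of the monomial of R is supported on a face only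
   inside F. Hence the colon ideal of I by this monomial is the prime of F. *)
have supp_sub m : (mnm_support (m + mnm_set R)%MM \in generated (rcons Fs F)) =
    (mnm_support m \subset F).
  rewrite mnm_supportD mnm_support_set inE has_rcons subUset RF andbT.
  case: hasP => [[G GFs]|]; last by rewrite orbF.
  by rewrite subUset => /andP [_ RG]; have := RFs _ GFs; rewrite RG.
apply: (weakly_regular_colon (J := vanishing (powerset F)) (g := 'X_[mnm_set R])) => //.
  move=> x; split=> Ix m mF.
    rewrite inE in mF; have := Ix (mnm_set R + m)%MM.
    by rewrite mulrC mcoeffMX addmC supp_sub => /(_ mF).
  rewrite mulrC mcoeffMX_le; case: ifP => // Rm; apply: Ix.
  by rewrite inE -supp_sub submK.
(* The faces that F adds are exactly those containing R, so adding the monomial of R to I gives the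
   ideal of the complex generated so far. *)
suff <- : vanishing (generated Fs) = extend I 'X_[mnm_set R] by [].
apply/funext => p; apply/propext; split; last first.
  apply: extend_min => // [q Iq m mFs|].
    by apply: Iq; move: mFs; rewrite !inE has_rcons => ->; rewrite orbT.
  apply: vanishing_monomial; rewrite mnm_support_set inE.
  by apply/hasPn => G /RFs.
apply: vanishing_ind; first exact: ideal_extend.
move=> m mFs; have [mF|mF] := boolP (mnm_support m \subset F).
  have Rm := minR _ mF mFs; rewrite -mnm_set_le in Rm.
  rewrite -(submK Rm) mpolyXD; apply: idealM; first exact: ideal_extend.
  exact: extend_gen.
apply: extend_sub => //; apply: vanishing_monomial.
by move: mFs; rewrite !inE has_rcons (negbTE mF).
Qed.

Lemma shelling_weakly_regular (D : complex V) Fs s : shelling D Fs ->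
    (forall F, F \in Fs -> weakly_regular (@vanishing k V (powerset F)) s) ->
  weakly_regular (@vanishing k V D) s.
Proof.
move=> [uFs mFs sFs] rFs; rewrite -(generated_facets mFs) -[Fs]take_size.
suff H j : (j <= size Fs)%N -> weakly_regular (@vanishing k V (generated (take j Fs))) s.
  exact: H.
elim: j => [|j IHj] jFs.
  by rewrite take0; apply: weakly_regular_total => p m; rewrite inE.
rewrite (take_nth set0) //; set F := nth set0 Fs j.
(* A subset of F missing some v in R lies in the corresponding earlier facet; the shelling condition
   puts an element of R outside each earlier facet. *)
pose R := [set v in F | [exists l : 'I_j, F :\: nth set0 Fs l == [set v]]].
apply: (@shelling_step _ _ R); last exact: IHj (ltnW jFs).
- by apply/subsetP => v; rewrite inE => /andP [].
- move=> G /(nthP set0) [i]; rewrite size_take jFs => ij <-.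
  rewrite nth_take //; apply/subsetPn.
  have [|v [l [vF lj e]]] := sFs i j; first by rewrite ij.
  move: vF; rewrite inE => /andP [vi vF]; exists v => //; rewrite inE vF /=.
  by apply/existsP; exists (Ordinal lj); apply/eqP.
- move=> G GF GFs; apply/subsetP => v; rewrite inE => /andP [vF /existsP [l /eqP e]].
  apply: contraNT GFs => vG; rewrite inE; apply/hasP; exists (nth set0 Fs l).
    have lFs : (l < size (take j Fs))%N by rewrite size_take jFs.
    by rewrite -(nth_take set0 (ltn_ord l)) mem_nth.
  apply/subsetP => w wG; apply: contraNT vG => wl.
  have : w \in F :\: nth set0 Fs l by rewrite inE wl (subsetP GF).
  by rewrite e inE => /eqP <-.
- by apply: rFs; apply: mem_nth.
Qed.

End ShellingRegular.

Section Colours.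
Variables (V : finType) (D : {set {set V}}).

Lemma colouring_fun s (C : 'I_s -> {set V}) : colouring D C ->
  exists2 col : V -> 'I_s, forall v j, (v \in C j) = (col v == j)
    & forall F, F \in D -> {in F &, injective col}.
Proof.
move=> [cov disj rain].
have ex v : exists j, v \in C j.
  by have /bigcupP [j _ vj] : v \in \bigcup_j C j; [rewrite cov inE | exists j].
have colE v j : (v \in C j) = (xchoose (ex v) == j).
  move: (xchoose (ex v)) (xchooseP (ex v)) => i vi.
  case: eqVneq => [<- //|ij].
  by rewrite (disjointFr (disj _ _ ij) vi).
exists (fun v => xchoose (ex v)) => // F FD v w vF wF /= vw.
have [G GD FG] := facet_above FD.
have /card_le1_eqP inj1 := rain G (xchoose (ex v)) GD.
by apply: inj1; rewrite inE (subsetP FG) // colE ?vw eqxx.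
Qed.

Lemma rainbow_onto s (col : V -> 'I_s) (F : {set V}) :
  {in F &, injective col} -> #|F| = s -> forall j, exists2 y, y \in F & col y = j.
Proof.
move=> inj cF j; have : col @: F = setT.
  by apply/eqP; rewrite eqEcard subsetT /= cardsT card_ord (card_in_imset inj) cF leqnn.
by move/setP => /(_ j); rewrite inE => /imsetP [y yF ->]; exists y.
Qed.

End Colours.

Section ShellableCohenMacaulay.
Local Open Scope ring_scope.
Variables (k : fieldType) (V : finType).

(** Such a regular sequence gives a prime chain of the same length, while [sr_regular_size] and
    [sr_chain_size] bound depth and height by the same number. *)
Lemma cohen_macaulay_crit (D : complex V) :
    (forall P : {pred sr_ring k D}, maximal_ideal P -> regular_length P (dimS D)) ->
  cohen_macaulay (sr_ring k D).
Proof.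
move=> reg P maxP; exists (dimS D); have rP := reg P maxP.
split; split=> //.
- by move=> i [s [<- _ rs]]; apply: sr_regular_size.
- have [s [<- sP /regular_sequenceE [rs _]]] := rP.
  have pP := maximal_ideal_prime maxP; have [[P0 _ _] _] := pP.
  apply: regular_prime_chain rs sP pP; first exact: ideal_zero.
  by move=> x ->.
- by move=> i; apply: sr_chain_size.
Qed.

Theorem shellable_cohen_macaulay (D : complex V) : balanced D -> shellable D ->
  cohen_macaulay (sr_ring k D).
Proof.
move=> [C /colouring_fun [col colE colI]] [pD [Fs sFs]].
apply: cohen_macaulay_crit => P maxP.
have alg j : exists p : {poly k}, p \is monic /\
    sr_proj D (map_poly (@mpolyC _ k) p).[linear_form k (C j)] \in P.
  have [p mp pP] := maximal_ideal_algebraic (sr_proj_surj (D := D)) (linear_form k (C j)) maxP.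
  by exists p.
have [p pP] := choice alg.
pose s := [seq (map_poly (@mpolyC _ k) (p j)).[linear_form k (C j)] | j <- enum 'I_(dimS D)].
have sP : {subset map (sr_proj D) s <= P}.
  by move=> x /mapP [_ /mapP [j _ ->] ->]; have [] := pP j.
exists (map (sr_proj D) s); split=> //; first by rewrite size_map /s size_map size_enum_ord.
apply/regular_sequenceE; split; last first.
  have [[P0 P1 _] _] := maxP; have iP := idealr_closed_ideal (proj1 maxP).
  move=> /(foldl_extend_min iP) P1'; case/negP: P1; apply: P1' => [y ->|] //.
apply/(weakly_regular_preim (sr_proj_surj (D := D))).
have -> : (fun y => y = 0) \o sr_proj (k := k) D = @vanishing k V D.
  by apply: funext => x; apply/propext; apply: sr_proj_eq0.
apply: (shelling_weakly_regular sFs) => F FFs.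
have FD : F \in facets D by case: sFs => _ <-.
have cF : #|F| = dimS D by rewrite (dimS_pure pD FD).
(* By purity F has as many vertices as there are colours, so it has one of each colour; it separates
   its colour class. *)
have ex_y j : exists y, y \in F /\ col y = j.
  by have [y yF yj] := rainbow_onto (colI _ (facet_face FD)) cF j; exists y.
have [y yP] := choice ex_y.
apply: (separated_regular (y := y)) => [|||i j ij|j|j].
- by apply: ideal_vanishing => A B AB; rewrite !inE; apply: subset_trans.
- exact: enum_uniq.
- by move=> j; rewrite colE; case: (yP j) => _ ->.
- by rewrite colE; case: (yP i) => _ ->.
- by case: (pP j).
- by apply: separated_facet; case: (yP j).
Qed.

End ShellableCohenMacaulay.

(** * Koszul homology *)

Section Koszul.
Local Open Scope ring_scope.
Variables (A : comNzRingType) (d : nat) (theta : 'I_d -> A).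
Implicit Types (T : {set 'I_d}) (i j l : 'I_d) (w z : {set 'I_d} -> A) (J : A -> Prop).

(** The sign that sorts e_j e_T in the exterior algebra, for j outside T. *)
Definition koszul_sign (B : comNzRingType) j T : B := (-1) ^+ #|[set l in T | (l < j)%N]|.

Lemma koszul_signU (B : comNzRingType) j l T : l \notin T ->
  koszul_sign B j (l |: T) = (-1) ^+ (l < j)%N * koszul_sign B j T.
Proof.
move=> lT; rewrite /koszul_sign -exprD; congr (_ ^+ _).
case: (ltnP l j) => lj.
  rewrite (_ : [set _ in _ | _] = l |: [set l0 in T | (l0 < j)%N]).
    by rewrite cardsU1 inE (negbTE lT).
  by apply/setP => x; rewrite !inE; case: eqP => // ->; rewrite lj.
rewrite add0n; apply: eq_card => x; rewrite !inE.
by case: eqP => // ->; rewrite (leq_gtF lj) !andbF.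
Qed.

Lemma koszul_sign_swap (B : comNzRingType) j l T : j != l -> j \notin T -> l \notin T ->
  koszul_sign B j T * koszul_sign B l (j |: T) =
  - (koszul_sign B l T * koszul_sign B j (l |: T)).
Proof.
move=> jl jT lT; rewrite !koszul_signU //.
case: (ltngtP j l) => [_|_|/val_inj jl']; last by rewrite jl' eqxx in jl.
  by rewrite expr0 expr1; ring.
by rewrite expr0 expr1; ring.
Qed.

Lemma koszul_sign_sq (B : comNzRingType) j T : koszul_sign B j T * koszul_sign B j T = 1.
Proof. by rewrite /koszul_sign -exprD addnn -mul2n exprM sqrrN expr1n expr1n. Qed.

(** With w standing for the sum of the w T e_T, this is the coefficient at e_T of the Koszul
    differential, which lowers the degree by one. *)
Definition koszul_diff w T : A :=
  \sum_(j | j \notin T) koszul_sign A j T * theta j * w (j |: T).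

Lemma sum_antisym (G : 'I_d -> 'I_d -> A) :
  (forall j, G j j = 0) -> (forall j l, G j l = - G l j) -> \sum_j \sum_l G j l = 0.
Proof.
move=> G0 GN; rewrite pair_bigA (bigID (fun p : 'I_d * 'I_d => (p.1 < p.2)%N)) /=.
rewrite [X in _ + X](bigID (fun p : 'I_d * 'I_d => p.1 == p.2)) /= [X in _ + (X + _)]big1 ?add0r.
  rewrite [X in _ + X](reindex_inj (h := fun p : 'I_d * 'I_d => (p.2, p.1))) /=; last first.
    by move=> [a b] [c e] [-> ->].
  rewrite [X in _ + X](eq_big (fun p : 'I_d * 'I_d => (p.1 < p.2)%N)
      (fun p => - G p.1 p.2)).
  - by rewrite sumrN addrN.
  - by move=> p; rewrite -leqNgt -val_eqE /=; case: ltngtP.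
  - by move=> p _; rewrite GN.
by move=> [a b] /andP [_ /eqP /= ->]; rewrite G0.
Qed.

Lemma koszul_diff_diff w T : koszul_diff (koszul_diff w) T = 0.
Proof.
pose G j l := if [&& j \notin T, l \notin T & j != l] then
  koszul_sign A j T * koszul_sign A l (j |: T) * (theta j * theta l * w (l |: (j |: T))) else 0.
transitivity (\sum_j \sum_l G j l).
  rewrite /koszul_diff big_mkcond; apply: eq_bigr => j _.
  case: ifP => jT; last by rewrite big1 // => l _; rewrite /G jT.
  rewrite big_distrr /= big_mkcond; apply: eq_bigr => l _.
  rewrite /G jT !inE negb_or andbC /= [l == j]eq_sym.
  by case: ifP => // _; rewrite -!mulrA; congr (_ * _); rewrite !mulrA; congr (_ * _); ring.
apply: sum_antisym => [j|j l]; first by rewrite /G eqxx !andbF.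
rewrite /G [l == j]eq_sym; case: (boolP (j \in T)) => jT; first by rewrite andbF oppr0.
case: (boolP (l \in T)) => lT /=; first by rewrite oppr0.
case: eqVneq => [|jl]; first by rewrite oppr0.
by rewrite koszul_sign_swap // setUCA mulNr [theta l * _]mulrC.
Qed.

(** Exterior multiplication by e_j, the homotopy by which theta j acts as zero on Koszul
    homology. *)
Definition koszul_mul j z T : A :=
  if j \in T then koszul_sign A j (T :\ j) * z (T :\ j) else 0.

Lemma koszul_homotopy j z T :
  koszul_diff (koszul_mul j z) T + koszul_mul j (koszul_diff z) T = theta j * z T.
Proof.
rewrite [X in _ + X]/koszul_mul; case: (boolP (j \in T)) => jT; last first.
  rewrite addr0 /koszul_diff (bigD1 j) //= big1 => [|l /andP [lT lj]].
    rewrite addr0 /koszul_mul setU11 setU1K // mulrAC mulrA koszul_sign_sq mul1r mulrC.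
    by rewrite mulrC.
  by rewrite /koszul_mul !inE eq_sym (negbTE lj) (negbTE jT) mulr0.
set T' := T :\ j; have TE : T = j |: T' by rewrite setD1K.
have jT' : j \notin T' by rewrite !inE eqxx.
rewrite {2}/koszul_diff (bigD1 j) //= -TE mulrDr !mulrA koszul_sign_sq mul1r.
rewrite addrCA -[RHS]addr0; congr (_ + _).
rewrite /koszul_diff big_distrr /= [X in _ + X](eq_bigl (fun l => l \notin T)) => [|l].
  rewrite -big_split big1 //= => l lT.
  have lT' : l \notin T' by apply: contra lT; rewrite !inE => /andP [].
  have jl : j != l by apply: contraNneq lT => <-.
  rewrite /koszul_mul !inE jT orbT.
  have -> : (l |: T) :\ j = l |: T'.
    by rewrite TE setUCA setU1K // !inE negb_or jl eqxx.
  have e : koszul_sign A l T * koszul_sign A j (l |: T') =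
      - (koszul_sign A j T' * koszul_sign A l T').
    rewrite TE !koszul_signU //; case: (ltngtP j l) => [_|_|/val_inj jl'].
    - by rewrite expr0 expr1; ring.
    - by rewrite expr0 expr1; ring.
    - by rewrite jl' eqxx in jl.
  transitivity ((koszul_sign A l T * koszul_sign A j (l |: T') +
    koszul_sign A j T' * koszul_sign A l T') * (theta l * z (l |: T'))); first by ring.
  by rewrite e addNr mul0r.
by rewrite !inE negb_and negbK; case: (eqVneq l j) => [->|]; rewrite ?jT ?andbF ?andbT.
Qed.

Lemma koszul_diffB w z T : koszul_diff (fun U => w U - z U) T = koszul_diff w T - koszul_diff z T.
Proof. by rewrite /koszul_diff -sumrB; apply: eq_bigr => j _; rewrite mulrBr. Qed.

Lemma koszul_diffD w z T : koszul_diff (fun U => w U + z U) T = koszul_diff w T + koszul_diff z T.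
Proof. by rewrite /koszul_diff -big_split; apply: eq_bigr => j _; rewrite mulrDr. Qed.

Lemma koszul_diffM a w T : koszul_diff (fun U => a * w U) T = a * koszul_diff w T.
Proof. by rewrite /koszul_diff mulr_sumr; apply: eq_bigr => j _; rewrite mulrCA. Qed.

Lemma koszul_diff_ideal J w T : ideal J ->
  (forall U : {set 'I_d}, #|U| = #|T|.+1 -> J (w U)) -> J (koszul_diff w T).
Proof.
move=> iJ Jw; apply: (ideal_sum _ iJ) => j jT; apply: (idealM _ iJ); apply: Jw.
by rewrite cardsU1 jT.
Qed.

(** Only the values on sets of size n matter. The successor on the left makes every family a cycle
    in degree 0. *)
Definition koszul_cycle J n z := forall T, #|T|.+1 = n -> J (koszul_diff z T).

Definition koszul_boundary J n z :=
  exists w, forall T, #|T| = n -> J (z T - koszul_diff w T).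

Definition koszul_exact J n := forall z, koszul_cycle J n z -> koszul_boundary J n z.

Lemma koszul_exact_large J n : (d < n)%N -> koszul_exact J n.
Proof.
move=> dn z _; exists (fun=> 0) => T cT; have := max_card (mem T).
by rewrite card_ord cT leqNgt dn.
Qed.

(** This is the annihilator of the class of z, to which the nilpotency hypothesis of
    [koszul_exact_regular] is applied. *)
Lemma ideal_koszul_boundary J n z : ideal J ->
  ideal (fun a => koszul_boundary J n (fun T => a * z T)).
Proof.
move=> iJ; split=> [|a b [w Jw] [w' Jw']|a b [w Jw]].
- exists (fun=> 0) => T _; rewrite mul0r sub0r; apply: (idealN iJ).
  by apply: (koszul_diff_ideal iJ) => U _; apply: ideal0.
- exists (fun T => w T + w' T) => T cT; rewrite koszul_diffD mulrDl opprD addrACA.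
  by apply: (idealD iJ); [apply: Jw | apply: Jw'].
- exists (fun T => a * w T) => T cT; rewrite koszul_diffM -mulrA -mulrBr.
  by apply: (idealM _ iJ); apply: Jw.
Qed.

Lemma koszul_boundary_theta J n z j : ideal J -> koszul_cycle J n z ->
  koszul_boundary J n (fun T => theta j * z T).
Proof.
move=> iJ cz; exists (koszul_mul j z) => T cT.
rewrite -koszul_homotopy [X in X - _]addrC addrK {1}/koszul_mul.
case: ifP => jT; last exact: ideal0.
by apply: (idealM _ iJ); apply: cz; rewrite -cT (cardsD1 j T) jT.
Qed.

Lemma koszul_boundary_ideal J n z a : ideal J -> J a -> koszul_boundary J n (fun T => a * z T).
Proof.
move=> iJ Ja; exists (fun=> 0) => T _; rewrite (_ : koszul_diff _ T = 0) ?subr0.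
  exact: idealMl.
by rewrite /koszul_diff big1 // => j _; rewrite mulr0.
Qed.

(* A cycle z with a * z = d w modulo J makes w a cycle modulo (J, a), and
   writing w = d u + a * v gives z = d v as a is a nonzerodivisor. *)
Lemma koszul_boundary_div J n z a : ideal J -> nonzerodiv J a ->
    koszul_exact (extend J a) n.+1 -> koszul_boundary J n (fun T => a * z T) ->
  koszul_boundary J n z.
Proof.
move=> iJ ra ex [w Jw].
have [T cT|u Ju] := ex w.
  exists (z T); rewrite -[_ - _]opprK opprB mulrC; apply: (idealN iJ).
  by apply: Jw; case: cT.
have {}Ju T : exists v, #|T| = n.+1 -> J (w T - koszul_diff u T - v * a).
  case: (eqVneq #|T| n.+1) => [cT|/eqP cT]; last by exists 0.
  by have [v Jv] := Ju T cT; exists v.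
have [v Jv] := choice Ju; exists v => T cT; apply: ra.
have -> : a * (z T - koszul_diff v T) = (a * z T - koszul_diff w T) +
    koszul_diff (fun U => w U - koszul_diff u U - v U * a) T.
  rewrite koszul_diffB koszul_diffB koszul_diff_diff subr0.
  rewrite (_ : koszul_diff (fun U => v U * a) T = a * koszul_diff v T); first by ring.
  by rewrite -koszul_diffM; apply: eq_bigr => j _; rewrite [a * _]mulrC.
apply: (idealD iJ); first exact: Jw.
by apply: (koszul_diff_ideal iJ) => U cU; apply: Jv; rewrite cU cT.
Qed.

(** Passing from J to J + (a) raises the degree by one and keeps [size s + n], until the degree
    exceeds d and the complex is zero. A power of a kills the class of z, and [koszul_boundary_div]
    removes its factors one by one. *)
Lemma koszul_exact_regular J s n : ideal J -> weakly_regular J s -> (d < size s + n)%N ->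
    (forall a (B : A -> Prop), a \in s -> ideal B -> (forall x, J x -> B x) ->
      (forall j, B (theta j)) -> exists N, B (a ^+ N)) ->
  koszul_exact J n.
Proof.
elim: s J n => [|a s IHs] J n iJ /=; first by move=> _ + _; apply: koszul_exact_large.
move=> [ra rs] dn nil z cz.
have [N] := nil a _ (mem_head a s) (ideal_koszul_boundary n z iJ)
  (fun x Jx => koszul_boundary_ideal n z iJ Jx)
  (fun j => koszul_boundary_theta j iJ cz).
have ex : koszul_exact (extend J a) n.+1.
  apply: IHs => //; first exact: ideal_extend; first by rewrite addnS.
  move=> b B bs iB JB; apply: nil => //; first by rewrite inE bs orbT.
  by move=> x Jx; apply: JB; apply: extend_sub.
elim: N => [|N IHN].
  by move=> [w Jw]; exists w => T cT; have := Jw T cT; rewrite expr0 mul1r.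
move=> bN; apply: IHN; apply: (koszul_boundary_div iJ ra ex).
by move: bN => [w Jw]; exists w => T /Jw; rewrite exprS mulrA.
Qed.


End Koszul.

Lemma ideal_radical (A : comNzRingType) (B : A -> Prop) : ideal B ->
  ideal (fun x => exists N, B (x ^+ N)%R).
Proof.
move=> iB; split=> [|x y [N BN] [M BM]|a x [N BN]].
- by exists 1%N; rewrite expr1; apply: ideal0.
- exists (N + M)%N; rewrite exprDn; apply: (ideal_sum _ iB) => i _.
  rewrite -mulr_natl; apply: (idealM _ iB).
  have [Mi|iM] := leqP M i.
    by rewrite -(subnK Mi) exprD; do 2![apply: (idealM _ iB)].
  have NNi : (N <= N + M - i)%N by lia.
  by rewrite -(subnK NNi) exprD; apply: (idealMl _ iB); apply: (idealM _ iB).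
- by exists N; rewrite exprMn; apply: (idealM _ iB).
Qed.

(** * The squarefree part of the Koszul complex of the colour forms *)

Section FaceComplex.
Local Open Scope ring_scope.
Variables (k : fieldType) (V : finType) (D : complex V) (d : nat) (col : V -> 'I_d).
Hypothesis colI : forall F, F \in faces D -> {in F &, injective col}.
Local Notation S := {mpoly k[#|V|]}.
Implicit Types (T : {set 'I_d}) (F G : {set V}) (w : {set 'I_d} -> S)
  (c : {set 'I_d} -> {set V} -> k).

Definition colour_class j : {set V} := [set v | col v == j].
Definition colour_form j : S := linear_form k (colour_class j).

Local Notation ideal_D := (@vanishing k V D).

Lemma ideal_vanishing_complex : ideal ideal_D.
Proof. by apply: ideal_vanishing; apply: complex_sub. Qed.

(** Multiply the colour form of v by the variable of v: apart from the square, every term joins two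
    vertices of the same colour, which is a nonface. *)
Lemma sq_variable_mem (B : S -> Prop) v : ideal B -> (forall p, ideal_D p -> B p) ->
  (forall j, B (colour_form j)) -> B ('X_(enum_rank v) * 'X_(enum_rank v)).
Proof.
move=> iB DB Bcol.
have vC : v \in colour_class (col v) by rewrite inE.
have -> : 'X_(enum_rank v) * 'X_(enum_rank v) = 'X_(enum_rank v) * colour_form (col v) -
    \sum_(w in colour_class (col v) :\ v) 'X_(enum_rank v) * 'X_(enum_rank w) :> S.
  by rewrite /colour_form /linear_form (big_setD1 v) //= mulrDr mulr_sumr addrK.
apply: (idealB iB); first by apply: (idealM _ iB); apply: Bcol.
apply: (ideal_sum _ iB) => w; rewrite !inE => /andP [wv /eqP cwv].
apply: DB; rewrite -mpolyXD; apply: vanishing_monomial; apply/negP => vwD.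
case/eqP: wv; by apply: (colI vwD) cwv; rewrite inE mnmDE !mnm1E eqxx ?addn1 ?add1n.
Qed.

Lemma nilpotent_mod_colour_forms (B : S -> Prop) a : ideal B ->
    (forall p, ideal_D p -> B p) -> (forall j, B (colour_form j)) ->
  a@_0 = 0 -> exists N, B (a ^+ N).
Proof.
move=> iB DB Bcol a0; have iR := ideal_radical iB.
rewrite [a]mpolyE big_seq_cond; apply: (ideal_sum _ iR) => m /andP [ma _].
have [i mi] : exists i, m i != 0%N.
  apply: contrapT => m0; move: ma; rewrite mcoeff_msupp (_ : m = 0%MM) ?a0 ?eqxx //.
  apply/mnmP => i; rewrite mnm0E; apply/eqP; apply: contra_notT m0 => mi.
  by exists i.
have mE : (U_(i) <= m)%MM.
  by apply/mnm_lepP => j; rewrite mnm1E; case: eqP => // <-; rewrite lt0n.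
rewrite -(submK mE) mpolyXD -mul_mpolyC; do 2![apply: (idealM _ iR)].
exists 2%N; rewrite expr2 -[i]enum_valK; exact: sq_variable_mem.
Qed.

Lemma colour_forms_exact s n : weakly_regular ideal_D s -> (d <= size s)%N ->
  (forall a, a \in s -> a@_0 = 0) -> (0 < n)%N -> koszul_exact colour_form ideal_D n.
Proof.
move=> rs ds s0 n0; apply: (koszul_exact_regular ideal_vanishing_complex rs).
  by rewrite -addn1 leq_add.
by move=> a B /s0 a0 iB DB Bcol; apply: nilpotent_mod_colour_forms a0.
Qed.

(** The index set of the terms X_F e_T in which no colour repeats, e_j having colour j. The
    differential replaces e_j by vertices of colour j and so respects the colours. *)
Definition rainbow_pair T F := (F \in faces D) && [disjoint col @: F & T].

Definition face_diff c T G : k :=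
  \sum_(v in G) koszul_sign k (col v) T * c (col v |: T) (G :\ v).

Lemma rainbow_pair_step T G v : rainbow_pair T G -> v \in G ->
  col v \notin T /\ rainbow_pair (col v |: T) (G :\ v).
Proof.
move=> /andP [GD dGT] vG.
have vT : col v \notin T by rewrite (disjointFr dGT) // imset_f.
split=> //; rewrite /rainbow_pair (complex_sub _ GD) ?subD1set //=.
apply/pred0P => j /=; rewrite !inE; apply/negP => /andP [/imsetP [w + ->]].
rewrite !inE => /andP [wv wG] /orP [/eqP|wT].
  by move/(colI GD wG vG) => e; rewrite e eqxx in wv.
by have := disjointFr dGT (imset_f col wG); rewrite wT.
Qed.

Lemma eq_face_diff c c' T G : rainbow_pair T G ->
  (forall v, v \in G -> c (col v |: T) (G :\ v) = c' (col v |: T) (G :\ v)) ->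
  face_diff c T G = face_diff c' T G.
Proof. by move=> _ cc'; apply: eq_bigr => v vG; rewrite cc'. Qed.

Definition face_coeff w T F : k := (w T)@_(mnm_set F).

Definition face_lift c T : S := \sum_(F | rainbow_pair T F) c T F *: 'X_[mnm_set F].

Lemma mcoeff_face_monomial F G : ('X_[mnm_set F] : S)@_(mnm_set G) = (F == G)%:R.
Proof.
rewrite mcoeffX; congr (_%:R); congr nat_of_bool; apply/eqP/eqP => [e|->//].
by rewrite -[F]mnm_support_set e mnm_support_set.
Qed.

Lemma face_lift_coeff c T F : rainbow_pair T F -> face_coeff (face_lift c) T F = c T F.
Proof.
move=> TF; rewrite /face_coeff /face_lift raddf_sum (bigD1 F) //=.
rewrite mcoeffZ mcoeff_face_monomial eqxx mulr1 big1 ?addr0 // => G /andP [_ GF].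
by rewrite mcoeffZ mcoeff_face_monomial (negbTE GF) mulr0.
Qed.

Lemma mnm_set1 (v : V) : mnm_set [set v] = U_(enum_rank v)%MM.
Proof.
by apply/mnmP => i; rewrite mnmE mnm1E inE -(inj_eq enum_rank_inj) enum_valK eq_sym.
Qed.

Lemma mnm_setU1 (v : V) F : v \notin F -> mnm_set (v |: F) = (mnm_set [set v] + mnm_set F)%MM.
Proof.
move=> vF; apply/mnmP => i; rewrite mnmDE !mnmE !inE.
by case: eqP => [->|]; rewrite ?(negbTE vF).
Qed.

Lemma mcoeff_variableM (v : V) (p : S) G : ('X_(enum_rank v) * p)@_(mnm_set G) =
  if v \in G then p@_(mnm_set (G :\ v)) else 0.
Proof.
rewrite mulrC -mnm_set1 mcoeffMX_le mnm_set_le sub1set mnm_support_set.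
case: ifP => [vG|//].
have vGv : v \notin G :\ v by rewrite !inE eqxx.
by rewrite -{1}(setD1K vG) (mnm_setU1 vGv) addmC addmK.
Qed.

(** The colours of G avoid T, so the pairs of a colour j outside T and a vertex of G of colour j are
    just the vertices of G. *)
Lemma koszul_diff_coeff w T G : rainbow_pair T G ->
  (koszul_diff colour_form w T)@_(mnm_set G) = face_diff (face_coeff w) T G.
Proof.
move=> TG; rewrite /koszul_diff /face_diff raddf_sum /=.
rewrite (partition_big col (fun j => j \notin T)) /=; last first.
  by move=> v vG; have [] := rainbow_pair_step TG vG.
apply: eq_bigr => j jT.
have -> : koszul_sign _ j T = (koszul_sign k j T)%:MP :> S.
  by rewrite /koszul_sign rmorphXn rmorphN rmorph1.
rewrite -mulrA mcoeffCM /colour_form /linear_form mulr_suml raddf_sum mulr_sumr /=.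
rewrite [LHS]big_mkcond [RHS]big_mkcond /=; apply: eq_bigr => v _.
rewrite inE; case: eqP => [<-|_]; last by rewrite andbF.
by rewrite mcoeff_variableM andbT; case: ifP => //; rewrite mulr0.
Qed.

Lemma face_diff_face_diff c T G : rainbow_pair T G -> face_diff (face_diff c) T G = 0.
Proof.
move=> TG.
transitivity (koszul_diff colour_form (koszul_diff colour_form (face_lift c)) T)@_(mnm_set G).
  rewrite koszul_diff_coeff //; apply: eq_bigr => v vG.
  have [_ TGv] := rainbow_pair_step TG vG.
  rewrite /face_coeff koszul_diff_coeff //; congr (_ * _); apply: eq_bigr => u uG.
  by have [_ TGvu] := rainbow_pair_step TGv uG; rewrite face_lift_coeff.
by rewrite koszul_diff_diff mcoeff0.
Qed.

(* The monomials occurring in koszul_diff (face_lift c) are squarefree. *)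
Lemma koszul_diff_lift c T :
  ideal_D (koszul_diff colour_form (face_lift c) T -
    \sum_(G | rainbow_pair T G) face_diff c T G *: 'X_[mnm_set G]).
Proof.
set p := _ - _.
(* All monomials of p are squarefree with colours outside T; at those supported on faces the two
   sides agree by [koszul_diff_coeff]. *)
pose good (q : S) := forall m, m \in msupp q ->
  exists2 G, m = mnm_set G & [disjoint col @: G & T].
have good0 : good 0 by move=> m; rewrite msupp0.
have goodD q r : good q -> good r -> good (q + r).
  by move=> gq gr m /msuppD_le; rewrite mem_cat => /orP [/gq|/gr].
have goodZ a q : good q -> good (a *: q) by move=> gq m /msuppZ_le /gq.
have goodX G : [disjoint col @: G & T] -> good 'X_[mnm_set G].
  by move=> GT m; rewrite msuppX inE => /eqP ->; exists G.
have gp : good p.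
  apply: (goodD _ _); last first.
    rewrite -scaleN1r; apply: (goodZ _ _); apply: (big_ind good good0 goodD) => G /andP [_ GT].
    by apply: (goodZ _ _); apply: (goodX _).
  apply: (big_ind good good0 goodD) => j jT; rewrite /face_lift mulr_sumr.
  apply: (big_ind good good0 goodD) => F /andP [FD dF].
  have -> : koszul_sign _ j T = (koszul_sign k j T)%:MP :> S.
    by rewrite /koszul_sign rmorphXn rmorphN rmorph1.
  rewrite -mulrA mul_mpolyC -scalerAr; do 2!apply: (goodZ _ _).
  rewrite /colour_form /linear_form mulr_suml; apply: (big_ind good good0 goodD) => v.
  rewrite inE => /eqP vj; rewrite -mnm_set1 -mpolyXD -mnm_setU1.
    apply: (goodX _); rewrite imsetU1 -setI_eq0 setIUl setU_eq0 !setI_eq0 disjoints1 vj jT /=.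
    exact: disjointWr (subsetUr _ _) dF.
  apply/negP => vF; have := disjointFr dF (imset_f col vF).
  by rewrite vj setU11.
move=> m mD; apply/eqP; rewrite mcoeff_eq0; apply/negP => mp.
have [G mG GT] := gp m mp.
have TG : rainbow_pair T G by rewrite /rainbow_pair GT andbT -(mnm_support_set G) -mG.
move: mp; rewrite mG mcoeff_msupp mcoeffB koszul_diff_coeff // raddf_sum (bigD1 G) //=.
rewrite mcoeffZ mcoeff_face_monomial eqxx mulr1 big1 ?addr0 => [|F /andP [_ FG]].
  rewrite (@eq_face_diff _ c) ?subrr ?eqxx // => v vG.
  by have [_ TGv] := rainbow_pair_step TG vG; rewrite face_lift_coeff.
by rewrite mcoeffZ mcoeff_face_monomial (negbTE FG) mulr0.
Qed.

(** Lift c to polynomials, use exactness of the Koszul complex, and read off the coefficients at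
    face monomials. *)
Lemma face_exact n c : koszul_exact colour_form ideal_D n ->
    (forall T G, rainbow_pair T G -> #|T|.+1 = n -> face_diff c T G = 0) ->
  exists u, forall T F, rainbow_pair T F -> #|T| = n -> c T F = face_diff u T F.
Proof.
move=> ex dc; have [T cT|w Jw] := ex (face_lift c).
  rewrite -[koszul_diff _ _ _](subrK
    (\sum_(G | rainbow_pair T G) face_diff c T G *: 'X_[mnm_set G])).
  have iD := ideal_vanishing_complex.
  apply: (idealD iD); first exact: koszul_diff_lift.
  by rewrite big1 => [|G TG]; [exact: (ideal0 iD) | rewrite dc // scale0r].
exists (face_coeff w) => T F TF cT.
have FD : mnm_support (mnm_set F) \in faces D by rewrite mnm_support_set; case/andP: TF.
have := Jw T cT _ FD; rewrite mcoeffB => /eqP; rewrite subr_eq0 => /eqP.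
by rewrite koszul_diff_coeff // => <-; apply/esym/face_lift_coeff.
Qed.

End FaceComplex.

(** * Standard faces *)

Section CoordinateSpaces.
Import Order.TTheory.
Local Open Scope ring_scope.
Variables (k : fieldType) (I : finType).
Implicit Types (A : {set I}) (u : 'rV[k]_#|I|) (x : I).

Definition coord_mx A : 'M[k]_(#|A|, #|I|) :=
  \matrix_(i, j) (enum_val i == enum_val j)%:R.

Definition coord_vec x : 'rV[k]_#|I| := delta_mx 0 (enum_rank x).

Lemma coord_vecE x y : coord_vec x 0 (enum_rank y) = (x == y)%:R.
Proof. by rewrite mxE eqxx (inj_eq enum_rank_inj) eq_sym. Qed.

Lemma sub_coord_mx A u : reflect (forall x, x \notin A -> u 0 (enum_rank x) = 0)
  (u <= coord_mx A)%MS.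
Proof.
apply: (iffP submxP) => [[v ->] x xA|u0].
  rewrite mxE big1 // => i _; rewrite mxE enum_rankK.
  case: eqP => [e|_]; last by rewrite mulr0.
  by rewrite -e enum_valP in xA.
exists (\row_i u 0 (enum_rank (enum_val i))); apply/rowP => j; rewrite mxE.
have [jA|jA] := boolP (enum_val j \in A); last first.
  rewrite -[j in LHS]enum_valK u0 // big1 // => i _; rewrite !mxE.
  case: eqP => [e|_]; last by rewrite mulr0.
  by rewrite -e enum_valP in jA.
rewrite (bigD1 (enum_rank_in jA (enum_val j))) //= !mxE enum_rankK_in // eqxx mulr1.
rewrite enum_valK big1 ?addr0 // => i; rewrite !mxE => ij.
case: eqP => [e|_]; last by rewrite mulr0.
case/eqP: ij.
by apply: enum_val_inj; rewrite enum_rankK_in.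
Qed.

Lemma rank_coord_mx A : \rank (coord_mx A) = #|A|.
Proof.
apply/eqP; rewrite -/(row_free _); apply/row_freeP; exists (coord_mx A)^T.
apply/matrixP => i j; rewrite !mxE (bigD1 (enum_rank (enum_val i))) //= !mxE.
rewrite enum_rankK eqxx mul1r (inj_eq enum_val_inj) [j == i]eq_sym big1 ?addr0 //.
move=> l li; rewrite !mxE; case: eqP => [e|_]; last by rewrite mul0r.
by rewrite e enum_valK eqxx in li.
Qed.

Lemma coord_mxU1 x A : (coord_mx (x |: A) :=: coord_mx A + coord_vec x)%MS.
Proof.
apply/eqmxP/andP; split; last first.
  rewrite addsmx_sub; apply/andP; split.
    apply/rV_subP => u /sub_coord_mx uA; apply/sub_coord_mx => y.
    by rewrite !inE negb_or => /andP [_ /uA].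
  apply/sub_coord_mx => y; rewrite !inE negb_or coord_vecE => /andP [yx _].
  by rewrite eq_sym (negbTE yx).
apply/rV_subP => u /sub_coord_mx uA.
rewrite -[u](subrK (u 0 (enum_rank x) *: coord_vec x)); apply: addmx_sub_adds.
  apply/sub_coord_mx => y yA; rewrite mxE mxE mxE coord_vecE.
  have [->|xy] := eqVneq x y; first by rewrite mulr1 subrr.
  by rewrite mulr0 subr0 uA // !inE negb_or eq_sym xy.
exact: scalemx_sub.
Qed.

Lemma rank_adds_vec m (W : 'M[k]_(m, #|I|)) x :
  \rank (W + coord_vec x)%MS = (\rank W + ~~ (coord_vec x <= W)%MS)%N.
Proof.
have rx : \rank (coord_vec x) = 1%N by rewrite /coord_vec mxrank_delta.
case: (boolP (coord_vec x <= W)%MS) => xW /=.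
  by rewrite addn0; apply/eqmx_rank; rewrite addsmxSl addsmx_sub submx_refl xW.
have := mxrank_sum_cap W (coord_vec x); rewrite rx => <-.
suff -> : \rank (W :&: coord_vec x)%MS = 0%N by rewrite addn0.
apply/eqP; apply: contraNT xW; rewrite -lt0n => r0.
have : (coord_vec x <= W :&: coord_vec x)%MS.
  by rewrite -(geq_leqif (mxrank_leqif_sup (capmxSr _ _))) rx.
by rewrite sub_capmx => /andP [].
Qed.

(* Gaussian elimination along the order f: the vectors not reduced by smaller
   ones form a basis modulo W. *)
Lemma rank_greedy disp (O : orderType disp) (f : I -> O) m (W : 'M[k]_(m, #|I|)) A :
    {in A &, injective f} ->
  \rank (W + coord_mx A)%MS = (\rank W + #|[set x in A |
    ~~ (coord_vec x <= W + coord_mx [set y in A | (f y < f x)%O])%MS]|)%N.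
Proof.
elim: {A}_.+1 {-2}A (ltnSn #|A|) => // n IHn A cA fA.
have [->|[x0 x0A]] := set_0Vmem A.
  rewrite [X in (_ + X)%N]eq_card0 ?addn0 => [|x]; last by rewrite !inE.
  apply/eqmx_rank; rewrite addsmxSl addsmx_sub submx_refl andbT /=.
  apply/rV_subP => u /sub_coord_mx u0; rewrite (_ : u = 0) ?sub0mx //.
  by apply/rowP => j; rewrite mxE -[j]enum_valK u0 // inE.
(* Removing the element with the largest value of f does not affect the test of any other
   element. *)
have [x xA xmax] := @arg_maxP _ _ _ x0 (fun x => x \in A) f x0A.
have {}xmax y : y \in A -> (f y <= f x)%O by exact: xmax.
pose A' := A :\ x; have AE : A = x |: A' by rewrite setD1K.
have lt_x y : y \in A -> (f y < f x)%O = (y != x).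
  by move=> yA; rewrite lt_neqAle xmax // andbT (inj_in_eq fA).
have nlt_x y : y \in A -> (f x < f y)%O = false.
  by move=> yA; rewrite ltNge xmax.
have A'x : [set y in A | (f y < f x)%O] = A'.
  by apply/setP => y; rewrite !inE; case: (boolP (y \in A)) => [/lt_x ->|]; rewrite ?andbF ?andbT.
have A'y y : y \in A' -> [set z in A | (f z < f y)%O] = [set z in A' | (f z < f y)%O].
  rewrite !inE => /andP [_ yA]; apply/setP => z; rewrite !inE.
  by case: eqVneq => // ->; rewrite nlt_x ?andbF.
have cA' : (#|A'| < n)%N by move: cA; rewrite (cardsD1 x A) xA.
have fA' : {in A' &, injective f}.
  by move=> y z; rewrite !inE => /andP [_ yA] /andP [_ zA]; apply: fA.
have -> : \rank (W + coord_mx A)%MS = \rank (W + coord_mx A' + coord_vec x)%MS.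
  rewrite AE -addsmxA; apply/eqmx_rank/eqmxP/adds_eqmx => //; exact: coord_mxU1.
rewrite rank_adds_vec (IHn A') // -addnA; congr (_ + _)%N.
rewrite (cardsD1 x [set z in A | _]) !inE xA A'x addnC; congr (_ + _)%N.
apply: eq_card => y; rewrite !inE; case: eqVneq => //= yx.
case: (boolP (y \in A)) => //= yA; rewrite A'y ?inE ?yx //.
Qed.

End CoordinateSpaces.

Section FaceComplexRanks.
Local Open Scope ring_scope.
Variables (k : fieldType) (V : finType) (D : complex V) (d : nat) (col : V -> 'I_d).
Hypothesis colI : forall F, F \in faces D -> {in F &, injective col}.
Local Notation S := {mpoly k[#|V|]}.
Local Notation I := ({set 'I_d} * {set V})%type.
Local Notation ideal_D := (@vanishing k V D).
Local Notation theta := (colour_form k col).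
Implicit Types (T : {set 'I_d}) (F G : {set V}) (u : 'rV[k]_#|{: I}|).

Definition row_fun u T F : k := u 0 (enum_rank (T, F)).

(** The differential in all degrees at once, acting on row vectors; [cells] selects the graded
    pieces. *)
Definition face_mx : 'M[k]_#|{: I}| :=
  \matrix_(i, j) let q := enum_val j in
    if rainbow_pair D col q.1 q.2 then face_diff col (row_fun (delta_mx 0 i)) q.1 q.2 else 0.

Lemma mul_face_mx u T G : (u *m face_mx) 0 (enum_rank (T, G)) =
  if rainbow_pair D col T G then face_diff col (row_fun u) T G else 0.
Proof.
rewrite mxE; under eq_bigr => i _ do rewrite mxE enum_rankK /=.
case: ifP => _; last by rewrite big1 // => i _; rewrite mulr0.
rewrite /face_diff; under eq_bigr => i _ do rewrite mulr_sumr.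
rewrite exchange_big; apply: eq_bigr => v _.
rewrite (bigD1 (enum_rank (col v |: T, G :\ v))) //= /row_fun mxE !eqxx mulr1 mulrC.
rewrite big1 ?addr0 // => i iv; rewrite mxE [_ == i]eq_sym (negbTE iv) andbF.
by rewrite mulr0 mulr0.
Qed.

(** n is the homological degree and s the total degree, which the differential preserves. *)
Definition cells n s : {set I} :=
  [set p : I | [&& rainbow_pair D col p.1 p.2, #|p.1| == n & (#|p.1| + #|p.2| == s)%N]].

Definition boundary_mx n s := coord_mx k (cells n s) *m face_mx.

Definition boundary_rank n s : nat := \rank (boundary_mx n s).

Lemma cells_step n s T G v : rainbow_pair D col T G -> v \in G ->
  ((col v |: T, G :\ v) \in cells n.+1 s) = ((T, G) \in cells n s).
Proof.
move=> TG vG; have [vT TGv] := rainbow_pair_step colI TG vG.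
rewrite !inE /= TGv TG cardsU1 vT (cardsD1 v G) vG /= add1n eqSS.
by rewrite addSn -addnS.
Qed.

Lemma sub_boundary_mx n s u (w : {set 'I_d} -> {set V} -> k) :
    (forall p, p \notin cells n s -> u 0 (enum_rank p) = 0) ->
    (forall T F, rainbow_pair D col T F -> #|T| = n ->
       u 0 (enum_rank (T, F)) = face_diff col w T F) ->
  (u <= boundary_mx n.+1 s)%MS.
Proof.
move=> u0 uw.
pose u' : 'rV[k]_#|{: I}| := \row_j let q := enum_val j in
  if q \in cells n.+1 s then w q.1 q.2 else 0.
have u'E p : u' 0 (enum_rank p) = if p \in cells n.+1 s then w p.1 p.2 else 0.
  by rewrite mxE enum_rankK.
have u'A : (u' <= coord_mx k (cells n.+1 s))%MS.
  by apply/sub_coord_mx => p pA; rewrite u'E (negbTE pA).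
suff -> : u = u' *m face_mx by apply: submxMr.
apply/rowP => j; rewrite -[j]enum_valK; case: (enum_val j) => T G; rewrite mul_face_mx.
case: ifP => [TG|nTG]; last by rewrite u0 // inE nTG.
have [TGA|TGA] := boolP ((T, G) \in cells n s).
  move: (TGA); rewrite inE => /and3P [_ /eqP cT _]; rewrite uw //.
  by apply: eq_bigr => v vG; rewrite /row_fun u'E cells_step // TGA.
rewrite u0 // /face_diff big1 // => v vG.
by rewrite /row_fun u'E cells_step // (negbTE TGA) mulr0.
Qed.

Lemma boundary_mx_supp n s u : (u <= boundary_mx n.+1 s)%MS ->
  (u <= coord_mx k (cells n s))%MS /\ u *m face_mx = 0.
Proof.
move=> /submxP [a ->]; rewrite mulmxA; set v := a *m _.
have vA : (v <= coord_mx k (cells n.+1 s))%MS by apply: submxMl.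
have v0 := sub_coord_mx _ _ vA; split.
  apply/sub_coord_mx => -[T G] TGA; rewrite mul_face_mx; case: ifP => // TG.
  rewrite /face_diff big1 // => x xG; rewrite /row_fun v0 ?mulr0 //.
  by rewrite cells_step.
apply/rowP => j; rewrite -[j]enum_valK; case: (enum_val j) => T G.
rewrite mul_face_mx mxE; case: ifP => // TG.
rewrite -[RHS](face_diff_face_diff colI (row_fun v) TG); apply: eq_bigr => x xG.
have [_ TGx] := rainbow_pair_step colI TG xG.
by rewrite {1}/row_fun mul_face_mx TGx.
Qed.

(** Rank-nullity: by exactness the kernel in degree n.+1 is the image from degree n.+2. *)
Lemma card_cells_exact n s : koszul_exact theta ideal_D n.+1 ->
  #|cells n.+1 s| = (boundary_rank n.+1 s + boundary_rank n.+2 s)%N.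
Proof.
move=> ex; have := mxrank_mul_ker (coord_mx k (cells n.+1 s)) face_mx.
rewrite rank_coord_mx => e; apply: etrans (esym e) _; congr (_ + _)%N.
apply: eqmx_rank; apply/andP; split; apply/rV_subP => u; last first.
  by move=> /boundary_mx_supp [uA u0]; rewrite sub_capmx uA; apply/sub_kermxP.
rewrite sub_capmx => /andP [/sub_coord_mx u0 /sub_kermxP uM].
have [|w uw] := face_exact colI (c := row_fun u) ex; last exact: sub_boundary_mx uw.
move=> T G TG cT; have := mul_face_mx u T G; rewrite uM mxE TG => -> //.
Qed.

Lemma card_cells n s : (n <= s)%N ->
  #|cells n s| = ('C(d - (s - n), n) * fnum D (s - n))%N.
Proof.
move=> ns; rewrite /fnum mulnC -sum_nat_const -sum1_card.
rewrite (partition_big snd (mem [set F in D | #|F| == s - n]%N)) /=; last first.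
  move=> [T F]; rewrite !inE /= => /and3P [/andP [-> _] /eqP -> /eqP <-].
  by rewrite addKn eqxx.
apply: eq_bigr => F; rewrite inE => /andP [FD /eqP cF]; rewrite sum1dep_card.
have cF' : #|col @: F| = (s - n)%N by rewrite card_in_imset // ; apply: colI.
transitivity #|[set T : {set 'I_d} | T \subset ~: (col @: F) & #|T| == n]|; last first.
  by rewrite cards_draws cardsCs setCK cF' card_ord.
rewrite -(card_imset (f := fun T => (T, F))) => [|T T' [] //].
apply: eq_card => -[T G]; rewrite !inE /=; apply/idP/imsetP.
  move=> /andP [/and3P [/andP [GD dG] cT cG] /eqP e]; exists T; last by rewrite e.
  by rewrite inE cT -disjoints_subset disjoint_sym -e dG.
case=> T'; rewrite inE => /andP [TF /eqP cT] [-> ->].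
by rewrite /rainbow_pair FD disjoint_sym disjoints_subset TF cT cF subnKC // !eqxx.
Qed.

Lemma alternating_rank s m :
    (forall n, koszul_exact theta ideal_D n.+1) ->
  \sum_(i < m.+1) (-1) ^+ i * #|cells i s|%:Z =
  #|cells 0%N s|%:Z - (boundary_rank 1%N s)%:Z
    + (-1) ^+ m * (boundary_rank m.+1 s)%:Z :> int.
Proof.
move=> ex; elim: m => [|m IHm].
  by rewrite big_ord_recr big_ord0 /= expr0; ring.
by rewrite big_ord_recr /= IHm card_cells_exact // PoszD exprS; ring.
Qed.

(** Read backwards, the sum defining the h-number is the Euler characteristic of the part of total
    degree s. Exactness makes it telescope to the dimension of the homology in degree 0. *)
Lemma hnum_rank s : dimS D = d -> (forall n, koszul_exact theta ideal_D n.+1) ->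
  hnum D s = #|cells 0%N s|%:Z - (boundary_rank 1%N s)%:Z.
Proof.
move=> dD ex; rewrite /hnum dD.
have r0 : boundary_rank s.+1 s = 0%N.
  apply/eqP; rewrite -leqn0; apply: leq_trans (rank_leq_row _) _.
  rewrite leqn0 cards_eq0; apply/eqP/setP => -[T F]; rewrite !inE /=.
  by apply/negP => /and3P [_ /eqP -> /eqP]; lia.
have := alternating_rank s s ex; rewrite r0 mulr0 addr0 => <-.
rewrite (reindex_inj rev_ord_inj) /=; apply: eq_bigr => i _.
have is_ : (i <= s)%N by rewrite -ltnS.
by rewrite subSS card_cells // subKn.
Qed.

End FaceComplexRanks.

Section StandardFaces.
Local Open Scope ring_scope.
Variables (k : fieldType) (V : finType) (D : complex V) (d : nat) (col : V -> 'I_d).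
Hypothesis colI : forall F, F \in faces D -> {in F &, injective col}.
Local Notation S := {mpoly k[#|V|]}.
Local Notation I := ({set 'I_d} * {set V})%type.
Local Notation ideal_D := (@vanishing k V D).
Local Notation theta := (colour_form k col).
Local Notation mon F := ('X_[mnm_set F] : S).
Implicit Types (T : {set 'I_d}) (F G : {set V}) (u : 'rV[k]_#|{: I}|).

(* The ideal generated by the colour forms and the Stanley-Reisner ideal, as the
   module of boundaries of degree 0. *)
Definition colour_ideal (a : S) : Prop :=
  koszul_boundary theta ideal_D 0 (fun=> a * 1).

Lemma ideal_colour_ideal : ideal colour_ideal.
Proof. exact/ideal_koszul_boundary/ideal_vanishing_complex. Qed.

Lemma colour_ideal_D p : ideal_D p -> colour_ideal p.
Proof. exact/koszul_boundary_ideal/ideal_vanishing_complex. Qed.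

Lemma colour_ideal_theta j : colour_ideal (theta j).
Proof. exact: (koszul_boundary_theta _ (ideal_vanishing_complex k D)). Qed.

Lemma colour_idealE p : colour_ideal p <->
  exists w, ideal_D (p - koszul_diff theta w set0).
Proof.
split=> [[w Jw]|[w Jw]]; exists w; first by rewrite -[p]mulr1; apply: Jw; rewrite cards0.
by move=> T /cards0_eq ->; rewrite mulr1.
Qed.

Lemma rainbow_pair0 F : rainbow_pair D col set0 F = (F \in faces D).
Proof. by rewrite /rainbow_pair -setI_eq0 setI0 eqxx andbT. Qed.

Lemma cells0 s p : (p \in cells D col 0 s) = [&& p.1 == set0, p.2 \in faces D & #|p.2| == s].
Proof.
case: p => T F; rewrite inE /= andbCA cards_eq0; case: eqP => //= ->.
by rewrite rainbow_pair0 cards0.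
Qed.

Lemma colour_ideal1 : ~ colour_ideal 1.
Proof.
move=> /colour_idealE [w]; have m0 : mnm_support (mnm_set (@set0 V)) \in faces D.
  by rewrite mnm_support_set complex_set0.
move=> /(_ _ m0) /eqP; rewrite mcoeffB (koszul_diff_coeff colI) ?rainbow_pair0 ?complex_set0 //.
rewrite /face_diff big_set0 subr0 mcoeff1 (_ : mnm_set set0 = 0%MM) ?eqxx ?oner_eq0 //.
by apply/mnmP => i; rewrite mnm0E mnmE inE.
Qed.

(** This links the linear algebra to the ideal: a boundary of the squarefree complex lifts to a
    Koszul boundary, and conversely the coefficients at face monomials give a preimage. *)
Lemma sub_boundary_colour s u : (forall p, p \notin cells D col 0 s -> u 0 (enum_rank p) = 0) ->
  (u <= boundary_mx k D col 1 s)%MS <->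
  colour_ideal (\sum_(F in faces D) u 0 (enum_rank (set0, F)) *: mon F).
Proof.
move=> u0; split=> [/submxP [a ue]|/colour_idealE [w Jw]].
  pose c := row_fun (a *m coord_mx k (cells D col 1 s)).
  have iC := ideal_colour_ideal.
  have -> : \sum_(F in faces D) u 0 (enum_rank (set0, F)) *: mon F =
      koszul_diff theta (face_lift D col c) set0 -
      (koszul_diff theta (face_lift D col c) set0 -
       \sum_(G | rainbow_pair D col set0 G) face_diff col c set0 G *: mon G).
    rewrite subKr; apply: eq_big => [F|F FD]; first by rewrite rainbow_pair0.
    by rewrite ue mulmxA mul_face_mx rainbow_pair0 FD.
  apply: (idealB iC); last exact/colour_ideal_D/(koszul_diff_lift colI).
  apply/colour_idealE; exists (face_lift D col c); rewrite subrr.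
  exact: (ideal0 (ideal_vanishing_complex k D)).
apply: (sub_boundary_mx colI u0 (w := face_coeff w)) => T F TF /cards0_eq T0.
rewrite T0 in TF *; have FD : F \in faces D by rewrite rainbow_pair0 in TF.
have FD' : mnm_support (mnm_set F) \in faces D by rewrite mnm_support_set.
have := Jw _ FD' => /eqP; rewrite mcoeffB (koszul_diff_coeff colI) // subr_eq0 => /eqP <-.
rewrite raddf_sum (bigD1 F) //= mcoeffZ mcoeff_face_monomial eqxx mulr1.
rewrite big1 ?addr0 // => G /andP [_ GF].
by rewrite mcoeffZ mcoeff_face_monomial (negbTE GF) mulr0.
Qed.

Definition smaller_faces F : {set {set V}} :=
  [set G in faces D | (#|G| == #|F|) && (mnm_set G < mnm_set F)%O].

(** Such a face monomial is a leading monomial of the colour ideal; the standard faces are the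
    remaining ones. *)
Definition reducible F : Prop := exists c : {set V} -> k,
  colour_ideal (mon F - \sum_(G in smaller_faces F) c G *: mon G).

Definition standard_faces : {set {set V}} := [set F in faces D | ~~ `[< reducible F >]].

Lemma colour_ideal_variable v G : v \in G -> colour_ideal ('X_(enum_rank v) * mon G).
Proof.
move=> vG; have iC := ideal_colour_ideal.
have vGv : v \notin G :\ v by rewrite !inE eqxx.
rewrite -{1}(setD1K vG) (mnm_setU1 vGv) mpolyXD mnm_set1 mulrA; apply: (idealMl _ iC).
exact: (sq_variable_mem colI v iC colour_ideal_D colour_ideal_theta).
Qed.

Lemma variable_face v G : v \notin G -> 'X_(enum_rank v) * mon G = mon (v |: G).
Proof. by move=> vG; rewrite mnm_setU1 // mnm_set1 mpolyXD. Qed.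

(** Multiply the relation for F by the variable of v. Terms with v in G lie in the ideal since
    squares of variables do, terms with v |: G a nonface lie in it too, and for the others the order
    is compatible with multiplication. *)
Lemma reducible_setU1 v F : v \notin F -> v |: F \in faces D -> reducible F ->
  reducible (v |: F).
Proof.
move=> vF vFD [c red]; have iC := ideal_colour_ideal.
pose c' (H : {set V}) := if v \in H then c (H :\ v) else 0.
exists c'.
have -> : mon (v |: F) - \sum_(H in smaller_faces (v |: F)) c' H *: mon H =
   'X_(enum_rank v) * (mon F - \sum_(G in smaller_faces F) c G *: mon G) +
   (\sum_(G in smaller_faces F) c G *: ('X_(enum_rank v) * mon G) -
    \sum_(H in smaller_faces (v |: F)) c' H *: mon H).
  rewrite mulrBr variable_face // mulr_sumr.
  under [X in _ = _ - X + _]eq_bigr => G _ do rewrite -scalerAr.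
  by rewrite addrA subrK.
apply: (idealD iC); first exact: (idealM _ iC).
set sm := smaller_faces F; set sm' := smaller_faces _.
pose P (G : {set V}) := (v \notin G) && (v |: G \in faces D).
rewrite (bigID P) /=.
have lt_mnm G : v \notin G -> (mnm_set (v |: G) < mnm_set (v |: F))%O = (mnm_set G < mnm_set F)%O.
  move=> vG; rewrite !mnm_setU1 //.
  by rewrite !Order.POrderTheory.lt_leAnge !lemc_add2r.
have -> : \sum_(G in sm | P G) c G *: ('X_(enum_rank v) * mon G) =
    \sum_(H in sm') c' H *: mon H.
  rewrite [RHS](bigID (fun H : {set V} => v \in H)) /= [X in _ + X]big1 ?addr0; last first.
    by move=> H /andP [_ vH]; rewrite /c' (negbTE vH) scale0r.
  rewrite (reindex_onto (fun H : {set V} => H :\ v) (fun G => v |: G)) /=; last first.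
    by move=> G /andP [_ /andP [vG _]]; rewrite setU1K.
  apply: eq_big => [H|H /andP [/andP [_ /andP [vH _]] /eqP HE]]; last first.
    by rewrite variable_face // HE /c' -HE setU11 setU1K ?inE ?eqxx.
  rewrite /P; case: (boolP (v \in H)) => vH; last first.
    rewrite andbF; apply/negP => /andP [_ /eqP e].
    by move: vH; rewrite -e setU11.
  have vHv : v \notin H :\ v by rewrite !inE eqxx.
  have ltH : (mnm_set H < mnm_set (v |: F))%O = (mnm_set (H :\ v) < mnm_set F)%O.
    by rewrite -(lt_mnm _ vHv) setD1K.
  rewrite setD1K // eqxx !andbT vHv /= !inE ltH cardsU1 vF (cardsD1 v H) vH eqSS.
  case: (boolP (H \in faces D)) => HD; last by rewrite andbF.
  by rewrite andbT (complex_sub (subD1set H v) HD).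
rewrite addrAC subrr add0r; apply: (ideal_sum _ iC) => G /andP [_ nPG].
rewrite -mul_mpolyC; apply: (idealM _ iC).
have [vG|vG] := boolP (v \in G); first exact: colour_ideal_variable.
rewrite variable_face //; apply/colour_ideal_D/vanishing_monomial.
by rewrite mnm_support_set; move: nPG; rewrite /P vG.
Qed.

Lemma standard_setU1 v F : v \notin F -> v |: F \in standard_faces -> F \in standard_faces.
Proof.
move=> vF; rewrite !inE => /andP [vFD nred]; rewrite (complex_sub (subsetUr _ _) vFD) /=.
apply: contra nred => /asboolP red; apply/asboolP; exact: reducible_setU1.
Qed.

Lemma standard_closed : down_closed standard_faces.
Proof.
move=> F G; move e : #|G :\: F| => n; elim: n G e => [|n IHn] G e FG GS.
  suff -> : F = G by [].
  by apply/eqP; rewrite eqEsubset FG -setD_eq0 -cards_eq0 e.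
have [v] : exists v, v \in G :\: F by apply/card_gt0P; rewrite e.
rewrite inE => /andP [vF vG]; apply: (IHn (G :\ v)).
- move: e; rewrite (cardsD1 v) inE vF vG => -[<-].
  by apply: eq_card => w; rewrite !inE andbCA.
- by rewrite subsetD1 FG.
- have vGv : v \notin G :\ v by rewrite !inE eqxx.
  by apply: (standard_setU1 vGv); rewrite setD1K.
Qed.

Lemma standard0 : set0 \in standard_faces.
Proof.
rewrite inE complex_set0 /=; apply/asboolPn => -[c].
rewrite big1 => [|G]; last first.
  rewrite inE cards0 cards_eq0 => /and3P [_ /eqP ->].
  by rewrite Order.POrderTheory.ltxx.
rewrite subr0 (_ : mnm_set set0 = 0%MM) ?mpolyX0; first exact: colour_ideal1.
by apply/mnmP => i; rewrite mnm0E mnmE inE.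
Qed.

Lemma mnm_set_inj : injective (@mnm_set V).
Proof. by move=> F G e; rewrite -[F]mnm_support_set e mnm_support_set. Qed.

(** Puts reducibility into the form tested by [rank_greedy]. *)
Lemma reducible_rank s F : F \in faces D -> #|F| = s ->
  reducible F <-> (coord_vec k (set0 : {set 'I_d}, F) <= boundary_mx k D col 1 s +
    coord_mx k [set y in cells D col 0 s | (mnm_set y.2 < mnm_set F)%O])%MS.
Proof.
move=> FD cF; set A := [set y in _ | _].
have memA G : ((set0, G) \in A) = (G \in smaller_faces F).
  by rewrite [LHS]inE [RHS]inE cells0 /= eqxx /= cF andbA.
have FA : (set0, F) \in cells D col 0 s by rewrite cells0 /= eqxx FD cF eqxx.
have supp u p : (u <= coord_mx k A)%MS -> p \notin cells D col 0 s ->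
    (coord_vec k (set0 : {set 'I_d}, F) - u) 0 (enum_rank p) = 0.
  move=> /sub_coord_mx uA pA; have pA' : p \notin A by rewrite in_set (negbTE pA).
  rewrite mxE coord_vecE mxE uA // subr0.
  by case: eqP => // e; rewrite -e FA in pA.
have sumE u : (u <= coord_mx k A)%MS ->
    \sum_(G in faces D) (coord_vec k (set0 : {set 'I_d}, F) - u) 0 (enum_rank (set0, G)) *: mon G
    = mon F - \sum_(G in smaller_faces F) u 0 (enum_rank (set0, G)) *: mon G.
  move=> /sub_coord_mx uA.
  under eq_bigr => G _ do rewrite mxE coord_vecE mxE scalerDl scaleNr.
  rewrite big_split /= sumrN; congr (_ - _).
    rewrite (bigD1 F) //= eqxx scale1r big1 ?addr0 // => G /andP [_ GF].
    by rewrite xpair_eqE eqxx eq_sym (negbTE GF) scale0r.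
  rewrite (bigID (fun G : {set V} => G \in smaller_faces F)) /= [X in _ + X]big1 ?addr0.
    by apply: eq_bigl => G; rewrite andb_idl // inE => /andP [].
  by move=> G /andP [_ nG]; rewrite uA ?memA ?scale0r.
split=> [[c red]|/sub_addsmxP [[a b] /= ab]].
  pose u : 'rV[k]_#|{: I}| := \row_j let p := enum_val j in if p \in A then c p.2 else 0.
  have uA : (u <= coord_mx k A)%MS.
    by apply/sub_coord_mx => p pA; rewrite mxE /= enum_rankK (negbTE pA).
  rewrite -[coord_vec _ _](subrK u); apply: addmx_sub_adds => //.
  apply/(sub_boundary_colour (supp u ^~ uA)); rewrite sumE //.
  rewrite (eq_bigr (fun G => c G *: mon G)) // => G GF.
  by rewrite mxE /= enum_rankK memA GF.
have bA : (b *m coord_mx k A <= coord_mx k A)%MS by apply: submxMl.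
exists (fun G => (b *m coord_mx k A) 0 (enum_rank (set0, G))).
rewrite -sumE //; apply/(sub_boundary_colour (fun p => supp _ p bA)).
by rewrite ab addrK submxMl.
Qed.

(** The greedy count for the boundaries inside the space of all cells of degree 0, ordered by their
    monomials: the standard faces form a basis of the quotient. *)
Lemma fnum_standard s :
  #|cells D col 0 s| = (boundary_rank k D col 1 s + fnum standard_faces s)%N.
Proof.
pose f (p : I) := mnm_set p.2.
have fI : {in cells D col 0 s &, injective f}.
  move=> [T F] [T' F']; rewrite !cells0 /= => /andP [/eqP -> _] /andP [/eqP -> _].
  by rewrite /f /= => /mnm_set_inj ->.
have := rank_greedy (boundary_mx k D col 1 s) fI.
rewrite (_ : \rank (_ + _)%MS = #|cells D col 0 s|); last first.
  rewrite -[RHS](rank_coord_mx k); apply/eqmx_rank.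
  rewrite addsmx_sub submx_refl addsmxSr !andbT.
  by apply/rV_subP => u /(boundary_mx_supp colI) [].
move=> ->; congr (_ + _)%N.
rewrite /fnum -(card_imset (f := fun F : {set V} => (set0 : {set 'I_d}, F))); last first.
  by move=> F G [].
apply: eq_card => -[T F]; rewrite inE cells0 /=; apply/idP/imsetP.
  move=> /andP [/and3P [/eqP -> FD /eqP cF] nred]; exists F => //.
  rewrite !inE FD cF eqxx andbT; apply: contra nred => /asboolP.
  by move/(reducible_rank FD cF).
case=> G; rewrite !inE => /andP [/andP [GD nred] /eqP cG] [-> ->].
rewrite eqxx GD cG eqxx /=; apply: contra nred => red; apply/asboolP.
exact/(reducible_rank GD cG).
Qed.

End StandardFaces.

(** * The irrelevant ideal of the Stanley-Reisner ring *)

Section IrrelevantIdeal.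
Local Open Scope ring_scope.
Variables (k : fieldType) (V : finType) (D : complex V).
Local Notation S := {mpoly k[#|V|]}.

Definition irrelevant_ideal : {pred sr_ring k D} :=
  [pred y | `[< exists2 p : S, sr_proj D p = y & p@_0 = 0 >]].

Lemma mem_irrelevant (p : S) : sr_proj D p \in irrelevant_ideal <-> p@_0 = 0.
Proof.
split=> [/asboolP [q qp q0]|p0]; last by apply/asboolP; exists p.
have : vanishing D (q - p) by apply/sr_proj_eq0; rewrite rmorphB /= qp subrr.
move=> /(_ 0%MM); rewrite (_ : mnm_support 0%MM = set0) ?complex_set0.
  by move=> /(_ isT) /eqP; rewrite mcoeffB q0 sub0r oppr_eq0 => /eqP.
by apply/setP => v; rewrite !inE mnm0E eqxx.
Qed.

Lemma irrelevant_maximal : maximal_ideal irrelevant_ideal.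
Proof.
split.
  split.
  - by rewrite -(rmorph0 (sr_proj D)); apply/mem_irrelevant; rewrite mcoeff0.
  - rewrite -(rmorph1 (sr_proj D)); apply/negP => /mem_irrelevant.
    by rewrite mcoeff1 eqxx => /eqP; rewrite oner_eq0.
  - move=> a x y; have [a' <-] := sr_proj_surj a; have [x' <-] := sr_proj_surj x.
    have [y' <-] := sr_proj_surj y; move=> /mem_irrelevant x0 /mem_irrelevant y0.
    rewrite -rmorphM -rmorphD; apply/mem_irrelevant.
    by rewrite mcoeffD y0 addr0 -/(mcoeff 0%MM _) rmorphM /= x0 mulr0.
move=> Q iQ PQ y; have iQ' := idealr_closed_ideal iQ; have [p <-] := sr_proj_surj y.
move=> pQ; apply/mem_irrelevant; have [_ Q1 _] := iQ.
apply: contraNeq Q1 => p0.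
have cQ : sr_proj D (p@_0)%:MP \in Q.
  rewrite -[_%:MP](subKr p) rmorphB /=; apply: (idealB iQ') => //; apply: PQ.
  by apply/mem_irrelevant; rewrite mcoeffB mcoeffC eqxx mulr1 subrr.
have := idealM (sr_proj D (p@_0)^-1%:MP) iQ' cQ.
by rewrite -rmorphM /= -mpolyCM mulVf // mpolyC1 rmorph1.
Qed.

(** Modulo the prime K of a facet of maximal size, the colour forms are weakly regular and lie in
    the irrelevant ideal, which gives a chain of primes above K. *)
Lemma irrelevant_chain (C : 'I_(dimS D) -> {set V}) : colouring D C ->
  prime_chain irrelevant_ideal (dimS D).
Proof.
move=> /colouring_fun [col colE colI].
have [F FD cF] := dimS_attained (complex_set0 D).
pose K := @vanishing k V (powerset F).
have iK : ideal K by apply: ideal_vanishing => A B AB; rewrite !inE; apply: subset_trans.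
have DK p : vanishing D p -> K p.
  move=> Dp m; rewrite inE => mF; apply: Dp; apply: complex_sub mF _.
  exact: facet_face FD.
pose J (y : sr_ring k D) := exists2 p, sr_proj D p = y & K p.
have JK : J \o sr_proj D = K.
  apply/funext => p; apply/propext; split=> [[q qp Kq]|Kp]; last by exists p.
  apply: (ideal_congr iK _ Kq); apply: DK; apply/sr_proj_eq0.
  by rewrite rmorphB /= qp subrr.
have iJ : ideal J.
  split=> [|_ _ [p <- Kp] [q <- Kq]|a _ [p <- Kp]].
  - by exists 0; [rewrite rmorph0 | apply: (ideal0 iK)].
  - by exists (p + q); [rewrite rmorphD | apply: (idealD iK)].
  - by have [b <-] := sr_proj_surj a; exists (b * p); [rewrite rmorphM | apply: (idealM _ iK)].
have ex_y j : exists y, y \in F /\ col y = j.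
  by have [y yF yj] := rainbow_onto (colI _ (facet_face FD)) cF j; exists y.
have [y yP] := choice ex_y.
(* With the polynomial 'X these are the linear forms themselves, written so that [separated_regular]
   applies. *)
pose s := [seq (map_poly (@mpolyC _ k) 'X).[linear_form k (C j)] | j <- enum 'I_(dimS D)].
have rs : weakly_regular K s.
  apply: (separated_regular (y := y) (p := fun=> 'X)) => // [|j|i j ij|j|j].
  - exact: enum_uniq.
  - by rewrite colE; case: (yP j) => _ ->.
  - by rewrite colE; case: (yP i) => _ ->.
  - exact: monicX.
  - by apply: separated_facet; case: (yP j).
rewrite -JK in rs; move/(weakly_regular_preim (sr_proj_surj (D := D))) in rs.
have ss : size (map (sr_proj D) s) = dimS D by rewrite size_map /s size_map size_enum_ord.
rewrite -ss; apply: regular_prime_chain iJ _ rs _ _.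
- move=> _ [p <- Kp]; apply/mem_irrelevant; apply: Kp.
  by rewrite inE; apply/subsetP => v; rewrite inE mnm0E eqxx.
- move=> x /mapP [_ /mapP [j _ ->] ->]; apply/mem_irrelevant.
  rewrite map_polyX hornerX /linear_form raddf_sum big1 // => v _.
  by rewrite /= mcoeffX mnm1_eq0.
- exact: maximal_ideal_prime irrelevant_maximal.
Qed.

(** At the irrelevant ideal the depth equals the height, which is at least [dimS D] by
    [irrelevant_chain]; a regular sequence of that depth is lifted to polynomials. *)
Lemma cohen_macaulay_regular (C : 'I_(dimS D) -> {set V}) : colouring D C ->
    cohen_macaulay (sr_ring k D) ->
  exists s : seq S, [/\ weakly_regular (@vanishing k V D) s, (dimS D <= size s)%N
    & forall a, a \in s -> a@_0 = 0].
Proof.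
move=> colC CM; have [n [[[a [an aP /regular_sequenceE [ra _]]] _] [_ hmax]]] :=
  CM _ irrelevant_maximal.
have [s sa] := map_surj (sr_proj_surj (D := D)) a; exists s; split.
- have -> : @vanishing k V D = (fun y => y = 0) \o sr_proj (k := k) D.
    by apply: funext => x; apply/propext; split=> /sr_proj_eq0.
  by apply/(weakly_regular_preim (sr_proj_surj (D := D))); rewrite sa.
- by rewrite -(size_map (sr_proj D)) sa an; apply/hmax/irrelevant_chain/colC.
- by move=> x xs; apply/mem_irrelevant/aP; rewrite -sa map_f.
Qed.

End IrrelevantIdeal.

(** * From Cohen-Macaulay complexes to f-vectors, and the equivalence *)

Theorem balanced_cohen_macaulay_f_vector (k : fieldType) (V : finType) (D : complex V)
    (m : seq nat) : all (fun i => 0 < i) m -> balanced D ->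
    cohen_macaulay (sr_ring k D) -> is_h_vector m D ->
  exists E : complex V, f_vector E = m.
Proof.
move=> m_gt0 [C colC] CM hm; have [s [rs ds s0]] := cohen_macaulay_regular colC CM.
have [col colE colI] := colouring_fun colC.
have ex n : koszul_exact (colour_form k col) (@vanishing k V D) n.+1.
  exact: (colour_forms_exact colI rs ds s0).
pose E := Complex (standard0 k colI) (standard_closed colI).
exists E.
have fE i : fnum (standard_faces k D col) i = nth 0 m i.
  have iD : Posz (fnum (standard_faces k D col) i) = nth 0%R (h_vector D) i.
    have [iD|Di] := ltnP i (dimS D).+1.
      by rewrite nth_mkseq // (hnum_rank colI i erefl ex)
        (fnum_standard k colI) PoszD addrC addKr.
    rewrite nth_default ?size_mkseq //; congr Posz; apply/eqP; rewrite cards_eq0.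
    apply/eqP/setP => F; rewrite !inE; apply/negP => /andP [/andP [/dimS_ge FD _] /eqP cF].
    by move: Di; rewrite -cF ltnNge FD.
  apply/eqP; rewrite -eqz_nat iD -trim_nth; move: hm; rewrite /is_h_vector => ->.
  have [im|mi] := ltnP i (size m); first by rewrite (nth_map 0).
  by rewrite !nth_default ?size_map.
have mpos i : (0 < nth 0 m i) = (i < size m).
  have [im|mi] := ltnP i (size m); last by rewrite nth_default.
  by apply: (allP m_gt0); apply: mem_nth.
(* As m is positive, its length is determined by its nonzero entries, and so by the largest size of
   a standard face. *)
have dE : (dimS E).+1 = size m.
  apply/eqP; rewrite eqn_leq; apply/andP; split.
    rewrite -mpos -fE; have [F FE cF] := dimS_attained (complex_set0 E).
    by apply/card_gt0P; exists F; rewrite inE (facet_face FE) cF eqxx.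
  have : 0 < fnum (standard_faces k D col) 0.
    by apply/card_gt0P; exists set0; rewrite inE (standard0 k colI) cards0 eqxx.
  rewrite fE mpos; case sm : (size m) => [|t] // _; rewrite ltnS.
  have : 0 < fnum (standard_faces k D col) t by rewrite fE mpos sm.
  by move=> /card_gt0P [F]; rewrite inE => /andP [FE /eqP <-]; apply: (@dimS_ge _ E).
apply: (@eq_from_nth _ 0) => [|i iE]; first by rewrite size_mkseq.
by rewrite nth_f_vector -fE.
Qed.

Theorem theorem1p2 (k : fieldType) (t : nat) (m : t.-tuple nat)
    (m_gt0 : forall i : 'I_t, 0 < tnth m i) :
  [<-> exists (V : finType) (D : complex V), f_vector D = m;
       exists (V : finType) (D : complex V),
         [/\ balanced D, vertex_decomposable D & is_h_vector m D];
       exists (V : finType) (D : complex V),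
         [/\ balanced D, shellable D & is_h_vector m D];
       exists (V : finType) (D : complex V),
         [/\ balanced D, cohen_macaulay (sr_ring k D) & is_h_vector m D]].
Proof.
have mpos : all (fun i => 0 < i) m by apply/all_tnthP.
tfae.
- by move=> [V [D Dm]]; apply: f_vector_is_balanced_vd_h_vector Dm.
- move=> [V [D [bD vdD hD]]]; exists V, D; split=> //; split.
    exact: vertex_decomposable_pure.
  by apply: vertex_decomposable_shelling vdD; apply: complex_sub.
- move=> [V [D [bD sD hD]]]; exists V, D; split=> //.
  exact: shellable_cohen_macaulay.
- move=> [V [D [bD cmD hD]]]; exists V.
  exact: balanced_cohen_macaulay_f_vector cmD hD.
Qed.
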